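(* Let $G=(V,E)$ be an infinite connected graph with maximal degree at most $K\in\mathbb N$. Let $(V_m)_{m\ge1}$ be an increasing sequence of finite subsets of $V$ with $\bigcup_m V_m=V$ such that the induced subgraphs $G_m$ are connected, and let $v_0\in V_1$. Let $\beta>0$, $u\in[0,1]$, $\theta=1$, and let $\mathbb P_m$ be the random loop measure on $G_m$ with parameters $(\beta,u,1)$. Let $p_c(G)$ be the critical parameter of Bernoulli bond percolation on $G$, and put \[ \delta(\beta,u,1)=\frac{1}{2}\left(\frac{u}{K}\right)^2\frac{\beta}{\beta+3\cdot 4^{K+1}}\left(\frac{\beta}{e^{\beta}-1}\right)^{2K-1}. \] If $(1-e^{-\beta})(1-\delta(\beta,u,1))<p_c(G)$, then loop percolation does not occur, i.e. \[ \liminf_{R\to\infty}\liminf_{m\to\infty}\mathbb P_m\big(v_0\Longleftrightarrow w\text{ for some } w\in V_m \text{ with } d(v_0,w)\ge R\big)=0, \] where $d$ denotes the graph distance.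
   Context: A link configuration on a finite graph $(V',E')$ is a finite sequence $c=(e_i,s_i)_{i\le n}$ with $n\in\mathbb N_0$, $e_i\in E'$ and $s_i\in\{-1,1\}$, where $s_i=1$ is a ''cross'' and $s_i=-1$ is a ''double bar''. Random loop measure with parameters $(\beta,u,1)$: draw independent $\mathrm{Poisson}(\beta)$ numbers of links for each edge. Order the resulting multiset of edges by a uniformly random permutation, and give each link independently type $1$ with probability $u$ and type $-1$ otherwise. Loops: place the $i$-th link at time $i/(n+1)$ on the edge $e_i$, and view time $[0,1)$ as a circle. A trajectory moving in time along a vertex jumps to the other endpoint of $e_i$ when it meets time $i/(n+1)$ at an endpoint of $e_i$. After a cross it continues in the same time direction, and after a double bar it reverses direction. The closed trajectories are the loops. For $v,w\in V'$, write $v\Longleftrightarrow w$ if the loop passing through $(v,0)$ also passes through $(w,0)$. *)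

(* Defs.v *)
From HB Require Import structures.
From mathcomp Require Import all_boot all_order all_algebra.
From mathcomp Require Import all_classical all_reals all_analysis.
Set Implicit Arguments.
Unset Strict Implicit.
Unset Printing Implicit Defensive.
Import Order.TTheory GRing.Theory Num.Theory numFieldNormedType.Exports.
Local Open Scope ring_scope.

Section Defs.
Variable V : countType.

Definition simple_graph (adj : rel V) : Prop :=
  (forall x y, adj x y = adj y x) /\ (forall x, ~~ adj x x).

Definition infinite_graph : Prop := ~ (exists s : seq V, forall x, x \in s).

Definition connected_graph (adj : rel V) : Prop :=
  forall x y, exists p : seq V, path adj x p /\ last x p = y.

Definition max_degree_le (adj : rel V) (K : nat) : Prop :=
  forall x (s : seq V), uniq s -> all (adj x) s -> (size s <= K)%N.

Definition induced_connected (adj : rel V) (S : seq V) : Prop :=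
  forall x y, x \in S -> y \in S ->
    exists p : seq V, [/\ path adj x p, last x p = y & all (mem S) p].

Definition dist_ge (adj : rel V) (v w : V) (R : nat) : Prop :=
  ~ (exists p : seq V, [/\ path adj v p, last v p = w & (size p < R)%N]).

(* edge list of the induced finite subgraph on S; each unordered edge {x,y}
   is listed once, as the ordered pair with pickle x < pickle y *)
Definition edges_of (adj : rel V) (S : seq V) : seq (V * V) :=
  [seq xy <- [seq (x, y) | x <- undup S, y <- undup S]
     | adj xy.1 xy.2 && (pickle xy.1 < pickle xy.2)%N].

(* A configuration is given as the sequence of its links (e_i, s_i), where
   e_i is the pair of endpoints and s_i = true means cross (s_i = 1) and
   s_i = false means double bar (s_i = -1).  Link i (1 <= i <= n) sits at
   time i/(n+1).  The circle minus the link times is cut into arcs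
   j = 0..n, arc j = (j/(n+1), (j+1)/(n+1)); arcs n and 0 are glued through
   time 0 (no link there).  A state (x, j, up) is the trajectory on vertex x
   in arc j moving up (up = true) or down in time. *)
Definition loop_step (L : seq ((V * V) * bool)) (s : V * nat * bool)
  : V * nat * bool :=
  let: (x, j, up) := s in
  let n := size L in
  if up then
    if (j < n)%N then
      let: ((a, b), cr) := nth ((x, x), true) L j in   (* link j+1 *)
      if (x == a) || (x == b) then
        let y := if x == a then b else a in
        if cr then (y, j.+1, true) else (y, j, false)
      else (x, j.+1, true)
    else (x, 0%N, true)                                (* cross time 0 *)
  else
    if (0 < j)%N then
      let: ((a, b), cr) := nth ((x, x), true) L j.-1 in (* link j *)
      if (x == a) || (x == b) then
        let y := if x == a then b else a in
        if cr then (y, j.-1, false) else (y, j, true)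
      else (x, j.-1, false)
    else (x, n, false).                                (* cross time 0 *)

(* v <==> w : the loop through (v,0) also passes through (w,0) *)
Definition same_loop (L : seq ((V * V) * bool)) (v w : V) : Prop :=
  exists t : nat, let s := iter t (loop_step L) (v, 0%N, true) in
    s.1.1 = w /\ s.1.2 = 0%N.

Definition links (E : seq (V * V)) (c : seq ('I_(size E) * bool))
  : seq ((V * V) * bool) :=
  [seq (tnth (in_tuple E) e.1, e.2) | e <- c].

Variable R : realType.

(* Random loop measure with parameters (beta, u, 1) on the finite graph with
   edge list E: the probability of the configuration c = (e_i, s_i)_{i<=n} is
   prod_e [e^{-beta} beta^{k_e}/k_e!] * (prod_e k_e!/n!) * u^{#crosses}
   (1-u)^{#double bars} = e^{-beta |E|} beta^n / n! * u^{#cr} (1-u)^{#db}. *)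
Definition loop_weight (k : nat) (beta u : R) (c : seq ('I_k * bool)) : R :=
  expR (- (beta * k%:R)) * beta ^+ size c / (size c)`!%:R
  * u ^+ count (fun e => e.2) c * (1 - u) ^+ count (fun e => ~~ e.2) c.

Local Open Scope ereal_scope.
Definition loop_prob (E : seq (V * V)) (beta u : R)
  (A : seq ('I_(size E) * bool) -> Prop) : \bar R :=
  \sum_(0 <= n <oo)
     (\sum_(c : n.-tuple ('I_(size E) * bool) | `[< A (tval c) >])
        loop_weight beta u (tval c))%R%:E.
Local Close Scope ereal_scope.

Definition open_adj (E : seq (V * V)) (w : {ffun 'I_(size E) -> bool}) : rel V :=
  fun x y => [exists i, w i && ((tnth (in_tuple E) i == (x, y))
                              || (tnth (in_tuple E) i == (y, x)))].

Definition perc_prob (E : seq (V * V)) (p : R)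
  (A : {ffun 'I_(size E) -> bool} -> Prop) : R :=
  \sum_(w | `[< A w >]) \prod_(i < size E) (if w i then p else 1 - p).

Definition perc_event (adj : rel V) (E : seq (V * V)) (v0 : V) (r : nat)
  (w : {ffun 'I_(size E) -> bool}) : Prop :=
  exists x, dist_ge adj v0 x r /\
    exists q : seq V, path (open_adj w) v0 q /\ last v0 q = x.

(* P_p(v0 <-> distance >= r) on G; the event only depends on the (finitely
   many) edges of the ball of radius r, so it is the eventually constant
   value of the same probability on G_m *)
Definition theta_r (adj : rel V) (Vm : nat -> seq V) (v0 : V) (p : R) (r : nat) : R :=
  limn ((fun m => perc_prob p (@perc_event adj (edges_of adj (Vm m)) v0 r)) : R^nat).

(* theta(p) = P_p(|C(v0)| = oo) = lim_r P_p(v0 <-> distance >= r) *)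
Definition theta (adj : rel V) (Vm : nat -> seq V) (v0 : V) (p : R) : R :=
  limn (theta_r adj Vm v0 p : R^nat).

Definition p_c (adj : rel V) (Vm : nat -> seq V) (v0 : V) : R :=
  sup [set p : R | 0 <= p <= 1 /\ theta adj Vm v0 p = 0].

Definition delta (K : nat) (beta u : R) : R :=
  2^-1 * (u / K%:R) ^+ 2 * (beta / (beta + 3 * 4 ^+ K.+1))
  * (beta / (expR beta - 1)) ^+ (2 * K).-1.
End Defs.

(* Main.v *)
(* Split the Poisson links of mean beta on each edge into those in a time window
   of Poisson mass lam and those outside.  Call an edge blocked if its only links
   are two crosses in the window and no adjacent edge has a link in the window.
   A trajectory entering a blocked edge through one cross comes back through the
   other one, so loops only connect vertices joined by a path of edges that carry
   a link and are not blocked.  Being blocked depends only on the numbers of links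
   per edge, window and sign, which are independent, so every edge carries one of
   four i.i.d. types and everything takes place in a finite product space.

   There, the law of the set of unblocked edges is compared with Bernoulli
   percolation one edge at a time.  Given the states of all other edges, the edge
   e is vacant with probability more than exp(-beta), because it can be blocked;
   the conditioning is controlled by surgeries that change the types of the edges
   near e without changing their states.  For a window carrying a fraction 1/(6K)
   of the probability of being open, the gain exceeds delta(beta,u,1), so loop
   connections are dominated by Bernoulli percolation with parameter p' for some
   p' with vanishing percolation probability. *)

Require Import Defs.
From HB Require Import structures.
From mathcomp Require Import all_boot all_order all_algebra.
From mathcomp Require Import all_classical all_reals all_analysis.
From mathcomp Require Import ring lra zify.
Set Implicit Arguments.
Unset Strict Implicit.
Unset Printing Implicit Defensive.
Import Order.TTheory GRing.Theory Num.Theory numFieldNormedType.Exports.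
Local Open Scope classical_set_scope.
Local Open Scope ring_scope.

(** * Functions of independent finite variables *)

Section Upd.
Variables (I : finType) (T : Type).
Implicit Types (t : {ffun I -> T}) (e i : I).

Definition upd t e (a : T) : {ffun I -> T} :=
  [ffun i => if i == e then a else t i].

Lemma updE t e a i : upd t e a i = if i == e then a else t i.
Proof. by rewrite ffunE. Qed.

Lemma upd_upd t e a b : upd (upd t e a) e b = upd t e b.
Proof. by apply/ffunP=> i; rewrite !ffunE; case: eqP. Qed.

Lemma updC t e e' a b : e != e' -> upd (upd t e a) e' b = upd (upd t e' b) e a.
Proof.
move=> ne; apply/ffunP=> i; rewrite !ffunE.
by case: (eqVneq i e') => // ->; rewrite eq_sym (negbTE ne).
Qed.

Lemma upd_id t e : upd t e (t e) = t.
Proof. by apply/ffunP=> i; rewrite !ffunE; case: eqP => // ->. Qed.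

End Upd.

Section IID.
Variables (R : realFieldType) (I T : finType) (w : T -> R).
Implicit Types (t : {ffun I -> T}) (F : {ffun I -> T} -> R).

Definition iid F : R := \sum_(t : {ffun I -> T}) (\prod_i w (t i)) * F t.

(** Resampling one coordinate by an independent copy preserves the product law: swapping the old
    value with the new one does not change the weight. *)
Lemma iid_upd e F :
  \sum_a w a = 1 -> iid F = \sum_a w a * iid (fun t => F (upd t e a)).
Proof.
move=> w1.
pose W t := \prod_(i | i != e) w (t i).
have WE t : \prod_i w (t i) = w (t e) * W t by rewrite (bigD1 e).
have Wu t a : W (upd t e a) = W t.
  by apply: eq_bigr => i /negbTE ie; rewrite updE ie.
pose g (p : {ffun I -> T} * T) : {ffun I -> T} * T := (upd p.1 e p.2, p.1 e).
have gK : involutive g.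
  by move=> [t a]; rewrite /g /= upd_upd upd_id updE eqxx.
transitivity (\sum_(p : {ffun I -> T} * T) w p.2 * (\prod_i w (p.1 i)) * F p.1).
  rewrite -(pair_bigA _ (fun t a => w a * (\prod_i w (t i)) * F t)) /=.
  apply: eq_bigr => t _.
  by rewrite -!mulr_suml w1 mul1r.
rewrite (reindex_inj (inv_inj gK)) -(pair_bigA _ (fun t a =>
  w (g (t, a)).2 * (\prod_i w ((g (t, a)).1 i)) * F (g (t, a)).1)) /=.
rewrite exchange_big; apply: eq_bigr => a _.
rewrite /iid mulr_sumr; apply: eq_bigr => t _.
by rewrite !WE Wu updE eqxx; ring.
Qed.

Hypothesis w_ge0 : forall a, 0 <= w a.

Lemma iid_weight_ge0 t : 0 <= \prod_i w (t i).
Proof. exact: prodr_ge0. Qed.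

Lemma iid_ge0 F : (forall t, 0 <= F t) -> 0 <= iid F.
Proof. by move=> F0; apply: sumr_ge0 => t _; rewrite mulr_ge0 ?iid_weight_ge0. Qed.

Lemma ler_iid F G : (forall t, F t <= G t) -> iid F <= iid G.
Proof. by move=> FG; apply: ler_sum => t _; rewrite ler_wpM2l ?iid_weight_ge0. Qed.

Lemma iid_cst c : \sum_a w a = 1 -> iid (fun=> c) = c.
Proof.
move=> w1; rewrite /iid -mulr_suml -(bigA_distr_bigA (fun _ a => w a)) /=.
by rewrite big1 ?mul1r.
Qed.

(* The constant [c i] pays for the values at [i] that [phi] merges. *)
Lemma iid_surgery (phi : {ffun I -> T} -> {ffun I -> T}) (rho : I -> T -> T -> bool)
    (c : I -> R) F :
  (forall t i, rho i (t i) (phi t i)) ->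
  (forall i b, \sum_(a | rho i a b) w a <= c i * w b) ->
  (forall t, 0 <= F t) ->
  iid (fun t => F (phi t)) <= (\prod_i c i) * iid F.
Proof.
move=> rho_phi rho_c F0.
rewrite /iid (partition_big phi predT) //= mulr_sumr; apply: ler_sum => t' _.
rewrite mulrA -big_split /=.
(* The fibre of [phi] over [t'] lies in a product set, over which the sum of the weights
   factorises. *)
apply: (@le_trans _ _ ((\sum_(t in family (fun i a => rho i a (t' i))) \prod_i w (t i)) * F t')).
  rewrite mulr_suml [leRHS](bigID (fun t => phi t == t')) /=.
  rewrite -[leLHS]addr0 lerD //.
    rewrite le_eqVlt; apply/orP; left; apply/eqP; apply: eq_big => t.
      case: (phi t =P t') => [<-|]; rewrite ?andbF ?andbT //.
      by apply/esym/familyP => i; exact: rho_phi.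
    by move=> /eqP ->.
  by apply: sumr_ge0 => t _; rewrite mulr_ge0 ?iid_weight_ge0.
rewrite ler_wpM2r //.
rewrite -(bigA_distr_big_dep (fun i a => rho i a (t' i)) (fun _ a => w a)).
apply: ler_prod => i _; rewrite rho_c andbT.
by apply: sumr_ge0.
Qed.

End IID.

(** * Domination of unblocked edges by Bernoulli percolation *)

Section Domination.
Variables (R : realFieldType) (I : finType) (nb : rel I).
Hypotheses (nbC : symmetric nb) (nb_irr : irreflexive nb).

(* [(t i).1] tells that edge [i] has a link in the window; [(t i).2] is [false]
   when [i] has no link, or has no link but two crosses in the window. *)
Definition opened (t : {ffun I -> bool * bool}) : {ffun I -> bool} :=
  [ffun i => (t i).2 || (t i).1 && [exists j, nb i j && (t j).1]].

Definition increasing (f : {ffun I -> bool} -> R) :=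
  forall x e, f (upd x e false) <= f (upd x e true).

Definition bern (q : R) (b : bool) : R := if b then q else 1 - q.

Definition resample (q : R) (e : I) (f : {ffun I -> bool} -> R) x : R :=
  q * f (upd x e true) + (1 - q) * f (upd x e false).

Lemma sum_bern q : \sum_b bern q b = 1.
Proof. by rewrite big_bool /bern /=; ring. Qed.

Lemma iid_resample q e f : iid (bern q) (resample q e f) = iid (bern q) f.
Proof.
rewrite [RHS](iid_upd e) ?sum_bern // big_bool /=.
rewrite /iid !mulr_sumr -big_split /=; apply: eq_bigr => x _.
by rewrite /resample /bern; ring.
Qed.

Lemma resample_increasing q e f :
  0 <= q <= 1 -> increasing f -> increasing (resample q e f).
Proof.
move=> /andP[q0 q1] incf x e'; rewrite /resample.
case: (eqVneq e' e) => [->|ne]; first by rewrite !upd_upd.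
by rewrite !(updC _ _ _ ne) lerD // ler_wpM2l // subr_ge0.
Qed.

(* The hypothesis says that, given the other coordinates of [X], coordinate [e]
   is [true] with probability at most [q]; coordinates are resampled one by one. *)
Lemma bern_domination (T : finType) (w : T -> R) (q : R)
    (X : {ffun I -> T} -> {ffun I -> bool}) f :
  0 <= q <= 1 -> \sum_a w a = 1 ->
  (forall e (D : {ffun I -> bool} -> R), (forall x, 0 <= D x) -> (forall x b, D (upd x e b) = D x) ->
    iid w (fun t => ((X t e)%:R - q) * D (X t)) <= 0) ->
  increasing f -> iid w (f \o X) <= iid (bern q) f.
Proof.
move=> q01 w1 key incf.
pose res s g := foldr (resample q) g s.
have res_inc s g : increasing g -> increasing (res s g).
  by move=> ig; elim: s => //= e s IH; exact: resample_increasing.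
have res_le s g : increasing g -> iid w (g \o X) <= iid w (res s g \o X).
  move=> ig; elim: s => //= e s IH; apply: le_trans IH _.
  set h := res s g; have ih : increasing h by exact: res_inc.
  rewrite -subr_le0 /iid -sumrB; under eq_bigr do rewrite -mulrBr.
  (* [h x] minus its resampled value is [(x e - q) * D x]; the discrete derivative [D] is
     nonnegative and does not depend on coordinate [e]. *)
  pose D x := h (upd x e true) - h (upd x e false).
  apply: le_trans (key e D _ _) => [|x|x b]; last 2 first.
  - by rewrite subr_ge0.
  - by rewrite /D !upd_upd.
  rewrite le_eqVlt; apply/orP; left; apply/eqP; apply: eq_bigr => t _ /=.
  congr (_ * _); rewrite /resample /D; set x := X t.
  have -> : h x = h (upd x e (x e)) by rewrite upd_id.
  by case: (x e) => /=; ring.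
have res_iid s g : iid (bern q) (res s g) = iid (bern q) g.
  by elim: s => //= e s IH; rewrite iid_resample.
have res_cst s g (x y : {ffun I -> bool}) : (forall i, i \notin s -> x i = y i) -> res s g x = res s g y.
  elim: s x y => [|e s IH] x y xy /=; first by congr g; apply/ffunP => i; exact: xy.
  rewrite /resample; congr (_ * _ + _ * _); apply: IH => i nis; rewrite !ffunE;
  by case: eqP => // /eqP ne; apply: xy; rewrite inE negb_or ne.
(* Once every coordinate is resampled the function is constant, and its mean is the same under both
   laws. *)
apply: le_trans (res_le (enum I) f incf) _.
pose c := res (enum I) f [ffun=> false].
have cE x : res (enum I) f x = c by apply: res_cst => i; rewrite mem_enum.
rewrite -(res_iid (enum I)).
have -> : iid w (res (enum I) f \o X) = iid w (fun _ : {ffun I -> T} => c).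
  by apply: eq_bigr => t _; rewrite /= cE.
have -> : iid (bern q) (res (enum I) f) = iid (bern q) (fun _ : {ffun I -> bool} => c).
  by apply: eq_bigr => t _; rewrite /= cE.
by rewrite !iid_cst ?sum_bern.
Qed.

Variable e : I.
(** [Zt]: no link. [Dt]: two crosses in the window and nothing else. [Gt]: links, all outside the
    window. [Bt]: every other type with a window link. *)
Local Notation Zt := (false, false).
Local Notation Dt := (true, false).
Local Notation Gt := (false, true).
Local Notation Bt := (true, true).

Lemma openedE t i :
  opened t i = (t i).2 || (t i).1 && [exists j, nb i j && (t j).1].
Proof. by rewrite ffunE. Qed.

Lemma opened_upd_bad t a b i : i != e -> a.1 = b.1 ->
  opened (upd t e a) i = opened (upd t e b) i.
Proof.
move=> ie ab; rewrite !openedE !updE (negbTE ie); congr (_ || _ && _).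
by apply: eq_existsb => j; rewrite !updE; case: eqP => // _; rewrite ab.
Qed.

(* If [e] gets rid of its window links, a [Dt]-neighbour of [e] with no other
   neighbour in the window would become blocked; changing it to [Gt] keeps it open. *)
Definition surgery1 (t : {ffun I -> bool * bool}) : {ffun I -> bool * bool} :=
  [ffun i => if [&& nb e i, t i == Dt & [forall j, nb i j ==> (j == e) || ~~ (t j).1]]
             then Gt else t i].

Lemma opened_surgery1 t i : i != e ->
  opened (upd (surgery1 t) e Zt) i = opened (upd t e Bt) i.
Proof.
move=> ie; rewrite !openedE !updE (negbTE ie) !ffunE.
case: ifP => [/and3P[ei /eqP -> _] /=|nconv].
  by apply/esym/existsP; exists e; rewrite nbC ei updE eqxx.
case Hti: (t i) => [[] []] //=.
case ei: (nb e i).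
  have -> : [exists j, nb i j && (upd t e Bt j).1].
    by apply/existsP; exists e; rewrite nbC ei updE eqxx.
  move: nconv; rewrite ei Hti eqxx /= => /forallPn[m].
  rewrite negb_imply negb_or negbK => /and3P[im me tm].
  (* [m] keeps its window links under the surgery, because its neighbour [i], other than [e], has
     one in [t]. *)
  apply/existsP; exists m; rewrite im updE (negbTE me) ffunE /=.
  case: ifP => // /and3P[_ _ /forallP /(_ i)].
  by rewrite nbC im (negbTE ie) Hti.
apply: eq_existsb => j; case ij: (nb i j) => //=; rewrite !updE ffunE.
case: (eqVneq j e) => [je|_]; first by rewrite nbC -je ij in ei.
case: ifP => // /and3P[_ _ /forallP /(_ i)].
by rewrite nbC ij (negbTE ie) Hti.
Qed.

Definition near2 i := [exists j, nb e j && nb j i].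

(* Clears the window at all neighbours of [e], keeping their states; the second
   case saves the edges that this clearing would newly block. *)
Definition surgery2 (t : {ffun I -> bool * bool}) : {ffun I -> bool * bool} :=
  [ffun i => let x := opened (upd t e Zt) in
    if nb e i then (if (t i).1 then (false, x i) else t i)
    else if [&& i != e, t i == Dt, x i, near2 i &
               [forall j, nb i j && (upd t e Zt j).1 ==> nb e j]]
    then Gt else t i].

Lemma surgery2_good t i : nb e i -> (surgery2 t i).1 = false.
Proof. by rewrite ffunE => -> /=; case: ifP. Qed.

Lemma opened_surgery2 t i : i != e ->
  opened (upd (surgery2 t) e Zt) i = opened (upd t e Zt) i.
Proof.
move=> ie; set x := opened (upd t e Zt).
rewrite openedE !updE (negbTE ie).
have xE : x i = (t i).2 || (t i).1 && [exists j, nb i j && (upd t e Zt j).1].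
  by rewrite /x openedE updE (negbTE ie).
case ei: (nb e i).
  rewrite surgery2_good // orbF ffunE /= ei -/x.
  by case tb: (t i).1 => //=; rewrite xE tb orbF.
rewrite ffunE /= ei ie -/x /=; case: ifP => [/and4P[_ -> _ _]//|nconv].
rewrite xE; case Hti: (t i) => [[] []] //=; rewrite Hti /= in xE.
rewrite -xE; case xi: (x i); last first.
  move: xE; rewrite xi => /esym/negbT/existsPn none.
  apply/negbTE/existsPn => j; have := none j.
  case ij: (nb i j) => //=; rewrite !updE; case: eqP => //= _.
  move=> /negbTE tj; rewrite ffunE /= tj.
  by case: ifP => _; [|case: ifP => _]; rewrite ?tj.
move: xE; rewrite xi => /esym /existsP[m0 /andP[im0 tm0]].
(* Otherwise all window neighbours of [i] would be adjacent to [e], and the surgery would have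
   turned [i] into [Gt]. *)
have [m /and3P[im tm nem]] : exists m, [&& nb i m, (upd t e Zt m).1 & ~~ nb e m].
  apply/existsP; case: (boolP [exists _, _]) => // /existsPn none.
  move: nconv; rewrite Hti xi /= => /negbT; rewrite negb_and; case/orP.
    move=> /existsPn /(_ m0); rewrite (nbC m0) im0 andbT.
    by have := none m0; rewrite im0 tm0 /= negbK => ->.
  move=> /forallPn[j]; rewrite negb_imply => /andP[/andP[ij tj] nej].
  by have := none j; rewrite ij tj nej.
(* [m] survives: it is converted only if all its window neighbours are adjacent to [e], and [i] is
   not. *)
apply/existsP; exists m; rewrite im /=.
move: tm; rewrite !updE; case: eqP => //= me tm.
rewrite ffunE /= (negbTE nem); case: ifP => // /and5P[_ _ _ _ /forallP /(_ i)].
by rewrite nbC im updE (negbTE ie) Hti ei.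
Qed.

End Domination.

Section EdgeTypes.
Variable R : realFieldType.
Local Notation Zt := (false, false).
Local Notation Dt := (true, false).
Local Notation Gt := (false, true).
Local Notation Bt := (true, true).

Lemma sum_flags (B : finType) (g : bool * B -> R) :
  \sum_a g a = \sum_b g (true, b) + \sum_b g (false, b).
Proof.
rewrite (eq_bigr (fun p => g (p.1, p.2))) => [|[? ?] //].
by rewrite -(pair_bigA _ (fun f b => g (f, b))) big_bool.
Qed.

Lemma sum_types (v : bool * bool -> R) : \sum_a v a = v Zt + v Dt + v Gt + v Bt.
Proof. by rewrite (sum_flags v) !big_bool /=; ring. Qed.

Lemma sum_types_cond (P : pred (bool * bool)) (v : bool * bool -> R) :
  \sum_(a | P a) v a = (if P Zt then v Zt else 0) + (if P Dt then v Dt else 0)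
    + (if P Gt then v Gt else 0) + (if P Bt then v Bt else 0).
Proof. by rewrite big_mkcond sum_types. Qed.

Lemma types_ind (P : bool * bool -> Prop) : P Zt -> P Dt -> P Gt -> P Bt -> forall y, P y.
Proof. by move=> ? ? ? ? [[] []]. Qed.

End EdgeTypes.

(** * The conditional probability that one edge is open *)

Section OpenedDomination.
Variables (R : realFieldType) (I : finType) (nb : rel I) (n : nat).
Hypotheses (nbC : symmetric nb) (nb_irr : irreflexive nb).
Hypothesis deg_nb : forall e, (#|nb e| <= n)%N.
Local Notation Zt := (false, false).
Local Notation Dt := (true, false).
Local Notation Gt := (false, true).
Local Notation Bt := (true, true).
(** [1 + r] is the price per edge of merging [Dt] into [Gt], and [c] that of clearing the window at
    an edge. [wq] says that the chance of blocking outweighs these prices. *)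
Variables (w : bool * bool -> R) (q r c : R).
Hypotheses (w_ge0 : forall a, 0 <= w a) (w_sum1 : \sum_a w a = 1).
Hypotheses (q01 : 0 <= q <= 1) (r_ge0 : 0 <= r) (c_ge1 : 1 <= c).
Hypothesis wD_le : w Dt <= r * w Gt.
Hypothesis w_to_G : w Dt + w Bt + w Gt <= c * w Gt.
Hypothesis w_to_Z : w Zt + w Dt <= c * w Zt.
Hypothesis wq : (1 - q) * (w Gt + (w Dt + w Bt) * (1 + r) ^+ n)
   <= q * w Zt + w Dt / (c ^+ n * (1 + r) ^+ (n * n)).

Lemma prod_if_le (P : pred I) (x : R) m :
  1 <= x -> (#|P| <= m)%N -> \prod_i (if P i then x else 1) <= x ^+ m.
Proof.
move=> x1 Pm; rewrite -big_mkcond prodr_const.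
exact: ler_weXn2l.
Qed.

Lemma card_near2 e : (#|near2 nb e| <= n * n)%N.
Proof.
apply: (@leq_trans (\sum_(j | nb e j) #|nb j|)).
  rewrite -sum1_card; under [X in (_ <= X)%N]eq_bigr do rewrite -sum1_card.
  rewrite (exchange_big_dep predT) //= big_mkcond; apply: leq_sum => i _.
  case: ifP => // /existsP[j /andP[ej ji]].
  by rewrite (bigD1 j) //= ej.
apply: (@leq_trans (\sum_(j | nb e j) n)); first exact: leq_sum.
by rewrite sum_nat_const leq_mul2r deg_nb orbT.
Qed.

(** Condition on the type of [e]. The first surgery compares the surroundings when [e] has window
    links with those when it has none; the second bounds from below the chance that no neighbour of
    [e] has a window link, whatever the other states. *)
Lemma iid_opened_le (e : I) (D : {ffun I -> bool} -> R) :
  (forall x, 0 <= D x) -> (forall x b, D (upd x e b) = D x) ->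
  iid w (fun t => ((opened nb t e)%:R - q) * D (opened nb t)) <= 0.
Proof.
move=> D0 De.
have Deq (x y : {ffun I -> bool}) : (forall i, i != e -> x i = y i) -> D x = D y.
  move=> xy; rewrite -(De x true) -(De y true); congr D; apply/ffunP => i.
  by rewrite !ffunE; case: eqVneq => // /xy.
(* [a], [a'] : the states away from [e] when [e] has no link, resp. some link, in
   the window; [h] : [e] is blocked as soon as it has type [Dt]. *)
pose a (t : {ffun I -> bool * bool}) := D (opened nb (upd t e Zt)).
pose a' (t : {ffun I -> bool * bool}) := D (opened nb (upd t e Bt)).
pose h (t : {ffun I -> bool * bool}) := [forall j, nb e j ==> ~~ (t j).1].
have DG t : D (opened nb (upd t e Gt)) = a t.
  by apply: Deq => i ie; apply: opened_upd_bad.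
have DD t : D (opened nb (upd t e Dt)) = a' t.
  by apply: Deq => i ie; apply: opened_upd_bad.
have ha t : h t -> a' t = a t.
  move=> /forallP ht; apply: Deq => i ie; rewrite !openedE !updE (negbTE ie).
  case Hti: (t i) => [[] b] //=; congr (_ || _); apply: eq_existsb => j.
  rewrite !updE; case: eqP => // ->.
  by have := ht i; rewrite Hti implybF nbC => /negbTE ->.
have OD t : opened nb (upd t e Dt) e = ~~ h t.
  rewrite openedE updE eqxx /= negb_forall; apply: eq_existsb => j.
  rewrite negb_imply negbK updE; case: eqP => // ->.
  by rewrite nb_irr.
have a0 t : 0 <= a t by exact: D0.
have a'0 t : 0 <= a' t by exact: D0.
have wZ0 := w_ge0 Zt; have wD0 := w_ge0 Dt; have wG0 := w_ge0 Gt; have wB0 := w_ge0 Bt.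
have [hr hc] := (r_ge0, c_ge1); have [hD [hG hZ]] := (wD_le, (w_to_G, w_to_Z)).
have /andP[q0 q1] := q01.
have rw x : 0 <= r * w x by exact: mulr_ge0.
have cw x : w x <= c * w x by rewrite ler_peMl.
have rcw x : 0 <= r * (c * w x) by rewrite !mulr_ge0 // (le_trans ler01).
have [[[rZ rD] rG] rB] := (rw Zt, rw Dt, rw Gt, rw Bt).
have [[[cZ cD] cG] cB] := (cw Zt, cw Dt, cw Gt, cw Bt).
have [[[rcZ rcD] rcG] rcB] := (rcw Zt, rcw Dt, rcw Gt, rcw Bt).
pose A := iid w a; pose A' := iid w a'; pose ah t := a t * (h t)%:R; pose H := iid w ah.
have A0 : 0 <= A by exact: iid_ge0.
(* Type [Zt] is closed, [Gt] and [Bt] are open; [Dt] is closed exactly under [h], where [a'] equals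
   [a], which yields the term in [H]. *)
have -> : iid w (fun t => ((opened nb t e)%:R - q) * D (opened nb t)) =
    A * ((1 - q) * w Gt - q * w Zt) + (1 - q) * (w Dt + w Bt) * A' - w Dt * H.
  rewrite (iid_upd e) // sum_types_cond /=.
  have -> : iid w (fun t => ((opened nb (upd t e Zt) e)%:R - q) * D (opened nb (upd t e Zt)))
      = - q * A.
    rewrite /A /iid mulr_sumr; apply: eq_bigr => t _.
    by rewrite openedE updE eqxx /= -/(a t); ring.
  have -> : iid w (fun t => ((opened nb (upd t e Gt) e)%:R - q) * D (opened nb (upd t e Gt)))
      = (1 - q) * A.
    rewrite /A /iid mulr_sumr; apply: eq_bigr => t _.
    by rewrite openedE updE eqxx /= DG; ring.
  have -> : iid w (fun t => ((opened nb (upd t e Bt) e)%:R - q) * D (opened nb (upd t e Bt)))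
      = (1 - q) * A'.
    rewrite /A' /iid mulr_sumr; apply: eq_bigr => t _.
    by rewrite openedE updE eqxx /= -/(a' t); ring.
  have -> : iid w (fun t => ((opened nb (upd t e Dt) e)%:R - q) * D (opened nb (upd t e Dt)))
      = (1 - q) * A' - H.
    rewrite /A' /H /ah /iid mulr_sumr -sumrB; apply: eq_bigr => t _.
    rewrite OD DD; case ht: (h t) => /=; last by ring.
    by rewrite ha //; ring.
  by ring.
have A'_le : A' <= (1 + r) ^+ n * A.
  have -> : A' = iid w (fun t => a (surgery1 nb e t)).
    apply: eq_bigr => t _; congr (_ * _); apply: Deq => i ie.
    by rewrite opened_surgery1.
  pose rho i (x y : bool * bool) := (x == y) || [&& nb e i, x == Dt & y == Gt].
  pose k i : R := if nb e i then 1 + r else 1.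
  apply: le_trans (iid_surgery (rho := rho) (c := k)
    w_ge0 _ _ a0) _.
  - move=> t i; rewrite /rho ffunE; case: ifP; last by rewrite eqxx.
    by case/and3P => -> ->; rewrite eqxx orbT.
  - move=> i; apply: types_ind; rewrite sum_types_cond /rho /k; case: (nb e i) => /=; lra.
  - by rewrite ler_wpM2r // prod_if_le ?deg_nb // lerDl.
have H_ge : A <= c ^+ n * (1 + r) ^+ (n * n) * H.
  have -> : A = iid w (fun t => ah (surgery2 nb e t)).
    apply: eq_bigr => t _; congr (_ * _).
    rewrite /ah; have -> /= : h (surgery2 nb e t).
      by apply/forallP => j; apply/implyP => ej; rewrite surgery2_good.
    rewrite mulr1; apply: Deq => i ie.
    by rewrite opened_surgery2.
  (* Clearing the window at a neighbour sends [Dt], [Gt], [Bt] to [Gt] when open, and [Zt], [Dt] to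
     [Zt] when closed. *)
  pose rho i (x y : bool * bool) :=
    if nb e i then ~~ y.1 && (if y.2 then x.1 || x.2 else ~~ x.2)
    else (x == y) || [&& near2 nb e i, x == Dt & y == Gt].
  pose k i : R := (if nb e i then c else 1) * (if near2 nb e i then 1 + r else 1).
  have r1 : 1 <= 1 + r by rewrite lerDl.
  apply: le_trans (iid_surgery (rho := rho) (c := k) (F := ah) w_ge0 _ _ _) _.
  - move=> t i; rewrite /rho ffunE /=.
    case ei: (nb e i).
      case Hti: (t i) => [[] []] //=; last by case: (opened nb _ i).
      by rewrite openedE updE; case: eqP => [ie|]; [rewrite ie nb_irr in ei|rewrite Hti].
    case: ifP; last by rewrite eqxx.
    by case/and5P => _ -> _ -> _; rewrite eqxx orbT.
  - move=> i; rewrite /rho /k; case: (nb e i); case: (near2 nb e i); apply: types_ind;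
      rewrite sum_types_cond /=; lra.
  - by move=> t; rewrite mulr_ge0.
  - rewrite ler_wpM2r ?iid_ge0 // => [t|]; first by rewrite mulr_ge0.
    rewrite /k big_split /= ler_pM ?prodr_ge0 // => [i _|i _||]; try by case: ifP; lra.
      by rewrite prod_if_le.
    by rewrite prod_if_le // card_near2.
have hq := wq; set C := c ^+ n * (1 + r) ^+ (n * n) in H_ge hq.
have C0 : 0 < C by rewrite mulr_gt0 // exprn_gt0; lra.
have HA : w Dt / C * A <= w Dt * H.
  by rewrite -mulrA ler_wpM2l // mulrC ler_pdivrMr // mulrC.
have h1 := ler_wpM2r A0 hq.
have h2 : (1 - q) * (w Dt + w Bt) * A' <= (1 - q) * (w Dt + w Bt) * ((1 + r) ^+ n * A).
  by rewrite ler_wpM2l // mulr_ge0 //; lra.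
lra.
Qed.

Lemma opened_domination f : increasing f ->
  iid w (f \o opened nb) <= iid (bern q) f.
Proof. by apply: bern_domination => // e D; exact: iid_opened_le. Qed.

End OpenedDomination.

(** * Poisson numbers of links in random order *)

Section WordSum.
Variable R : realFieldType.

Fixpoint wsum (A : finType) (x : A -> R) n (F : seq A -> R) : R :=
  if n is m.+1 then \sum_a x a * wsum x m (fun c => F (a :: c)) else F [::].

(* Unnormalised partial expectation of a Poisson number of independent letters. *)
Definition psum (A : finType) (x : A -> R) N (F : seq A -> R) : R :=
  \sum_(n < N) (n`!%:R)^-1 * wsum x n F.

Definition only (A : finType) (P : pred A) (x : A -> R) a : R :=
  if P a then x a else 0.

Variable A : finType.
Implicit Types (x : A -> R) (F G : seq A -> R) (P : pred A).

Lemma sum_tuple_wsum x n F :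
  \sum_(c : n.-tuple A) (\prod_(a <- c) x a) * F c = wsum x n F.
Proof.
elim: n F => [|n IH] F /=.
  rewrite (big_pred1 [tuple]) => [|c]; first by rewrite big_nil mul1r.
  by apply/esym/eqP; rewrite [c]tuple0.
have can1 : cancel (fun p : A * n.-tuple A => cons_tuple p.1 p.2)
                   (fun c : n.+1.-tuple A => (thead c, behead_tuple c)).
  by move=> [a c]; rewrite /= theadE; congr (_, _); apply: val_inj.
have can2 : cancel (fun c : n.+1.-tuple A => (thead c, behead_tuple c))
                   (fun p : A * n.-tuple A => cons_tuple p.1 p.2).
  by move=> c; rewrite [RHS]tuple_eta; apply: val_inj.
rewrite (reindex (fun p : A * n.-tuple A => cons_tuple p.1 p.2)) /=; last first.
  by exists (fun c : n.+1.-tuple A => (thead c, behead_tuple c)) => ? _; rewrite ?can1 ?can2.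
rewrite -(pair_bigA _ (fun a (c : n.-tuple A) =>
  (\prod_(b <- a :: c) x b) * F (a :: c))) /=.
apply: eq_bigr => a _; rewrite -IH mulr_sumr; apply: eq_bigr => c _.
by rewrite big_cons mulrA.
Qed.

Lemma eq_wsum x y n F G : x =1 y -> F =1 G -> wsum x n F = wsum y n G.
Proof.
move=> xy; elim: n F G => [|n IH] F G FG /=; first exact: FG.
by apply: eq_bigr => a _; rewrite xy (IH _ (fun c => G (a :: c))).
Qed.

Lemma eq_psum x y N F G : x =1 y -> F =1 G -> psum x N F = psum y N G.
Proof. by move=> xy FG; apply: eq_bigr => n _; rewrite (eq_wsum _ xy FG). Qed.

Lemma wsum_ge0 x n F : (forall a, 0 <= x a) -> (forall c, 0 <= F c) -> 0 <= wsum x n F.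
Proof.
move=> x0; elim: n F => [|n IH] F F0 //=.
by apply: sumr_ge0 => a _; rewrite mulr_ge0 // IH.
Qed.

Lemma ler_wsum x n F G :
  (forall a, 0 <= x a) -> (forall c, F c <= G c) -> wsum x n F <= wsum x n G.
Proof.
move=> x0; elim: n F G => [|n IH] F G FG //=.
by apply: ler_sum => a _; rewrite ler_wpM2l // IH.
Qed.

Lemma ler_psum x N F G :
  (forall a, 0 <= x a) -> (forall c, F c <= G c) -> psum x N F <= psum x N G.
Proof. by move=> x0 FG; apply: ler_sum => n _; rewrite ler_wpM2l ?invr_ge0 // ler_wsum. Qed.

Lemma psum_ge0 x N F : (forall a, 0 <= x a) -> (forall c, 0 <= F c) -> 0 <= psum x N F.
Proof. by move=> x0 F0; apply: sumr_ge0 => n _; rewrite mulr_ge0 ?invr_ge0 ?wsum_ge0. Qed.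

Lemma wsum_sum (J : finType) x n (F : J -> seq A -> R) :
  wsum x n (fun c => \sum_j F j c) = \sum_j wsum x n (F j).
Proof.
elim: n F => [|n IH] F //=.
rewrite exchange_big; apply: eq_bigr => a _.
by rewrite (IH (fun j c => F j (a :: c))) mulr_sumr.
Qed.

Lemma wsumZ x n k F : wsum x n (fun c => k * F c) = k * wsum x n F.
Proof.
elim: n F => [|n IH] F //=.
by rewrite mulr_sumr; apply: eq_bigr => a _; rewrite IH mulrCA.
Qed.

Lemma psum_sum (J : finType) x N (F : J -> seq A -> R) :
  psum x N (fun c => \sum_j F j c) = \sum_j psum x N (F j).
Proof.
rewrite /psum exchange_big; apply: eq_bigr => n _.
by rewrite wsum_sum mulr_sumr.
Qed.

Lemma psumZ x N k F : psum x N (fun c => k * F c) = k * psum x N F.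
Proof. by rewrite /psum mulr_sumr; apply: eq_bigr => n _; rewrite wsumZ mulrCA. Qed.

Lemma wsum_rcons x n F :
  wsum x n.+1 F = \sum_a x a * wsum x n (fun c => F (rcons c a)).
Proof.
elim: n F => [|n IH] F //.
transitivity (\sum_a x a * wsum x n.+1 (fun c => F (a :: c))) => //.
under eq_bigr do rewrite IH mulr_sumr.
rewrite exchange_big /=; apply: eq_bigr => a _; rewrite mulr_sumr.
by apply: eq_bigr => b _; rewrite mulrCA.
Qed.

Lemma wsum_all x n (g : nat -> R) P :
  wsum x n (fun c => g (size c) * (all P c)%:R) = g n * (\sum_(a | P a) x a) ^+ n.
Proof.
elim: n g => [|n IH] g /=; first by rewrite expr0.
rewrite exprS mulrCA mulr_suml [in RHS]big_mkcond; apply: eq_bigr => a _.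
case: ifP => Pa /=; first by rewrite (IH (fun m => g m.+1)).
rewrite (@eq_wsum x x n _ (fun=> 0 * 1)) => [|//|c]; last by rewrite mulr0 mul0r.
by rewrite (wsumZ x n 0 (fun=> 1)) mul0r mulr0.
Qed.

(** There are ['C(n, j)] interleavings of a word of length [j] in [P] with one of length [n - j]
    outside; the induction on the first letter is Pascal's rule. *)
Lemma wsum_split x P F G n :
  wsum x n (fun c => F (seq.filter P c) * G (seq.filter (predC P) c)) =
  \sum_(j < n.+1) 'C(n, j)%:R * (wsum (only P x) j F * wsum (only (predC P) x) (n - j) G).
Proof.
elim: n F G => [|n IH] F G; first by rewrite big_ord1 bin0 subn0 mul1r.
pose a j := wsum (only P x) j F; pose b j := wsum (only (predC P) x) j G.
have -> : wsum x n.+1 (fun c => F (seq.filter P c) * G (seq.filter (predC P) c)) =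
  \sum_(j < n.+1) 'C(n, j)%:R * (a j.+1 * b (n - j)%N) +
  \sum_(j < n.+1) 'C(n, j)%:R * (a j * b (n - j).+1).
  rewrite -big_split /=.
  under [RHS]eq_bigr => j _.
    rewrite /a /b /= !mulr_suml !mulr_sumr -big_split /=.
    over.
  rewrite exchange_big /=; apply: eq_bigr => l _.
  rewrite /only /=; case: (P l) => /=.
    rewrite (IH (fun c => F (l :: c))) mulr_sumr; apply: eq_bigr => j _.
    by rewrite mul0r mulr0 mulr0 addr0; ring.
  rewrite (IH F (fun c => G (l :: c))) mulr_sumr; apply: eq_bigr => j _.
  by rewrite !mul0r mulr0 add0r; ring.
rewrite -[X in X + _ = _](big_mkord predT (fun j => 'C(n, j)%:R * (a j.+1 * b (n - j)%N))).
rewrite -[X in _ + X = _](big_mkord predT (fun j => 'C(n, j)%:R * (a j * b (n - j).+1))).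
rewrite -[RHS](big_mkord predT (fun j => 'C(n.+1, j)%:R * (a j * b (n.+1 - j)%N))).
rewrite [RHS]big_nat_recl // [X in _ + X]big_nat_recl // !bin0 !subn0.
rewrite addrCA; congr (_ + _).
rewrite [in RHS]big_nat_recr //= [X in X + _ = _]big_nat_recr //= subSS subnn !binn.
rewrite addrAC; congr (_ + _).
rewrite -big_split /=; rewrite !big_nat; apply: eq_bigr => j /andP[_ jn].
by rewrite binS natrD mulrDl addrC subSS subnSK.
Qed.

(** The factor [1/n!] turns the binomial sum into a Cauchy product; truncation keeps only the pairs
    of total length below [N], hence an inequality. *)
Lemma psum_split_le x P F G N :
  (forall a, 0 <= x a) -> (forall c, 0 <= F c) -> (forall c, 0 <= G c) ->
  psum x N (fun c => F (seq.filter P c) * G (seq.filter (predC P) c)) <=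
  psum (only P x) N F * psum (only (predC P) x) N G.
Proof.
move=> x0 F0 G0.
have only0 Q a : 0 <= only Q x a by rewrite /only; case: ifP.
pose a j := (j`!%:R)^-1 * wsum (only P x) j F.
pose b j := (j`!%:R)^-1 * wsum (only (predC P) x) j G.
have a0 j : 0 <= a j by rewrite mulr_ge0 ?invr_ge0 ?wsum_ge0.
have b0 j : 0 <= b j by rewrite mulr_ge0 ?invr_ge0 ?wsum_ge0.
have -> : psum x N (fun c => F (seq.filter P c) * G (seq.filter (predC P) c)) =
    \sum_(n < N) \sum_(j < N | (j <= n)%N) a j * b (n - j)%N.
  apply: eq_bigr => n _; rewrite wsum_split.
  rewrite (big_ord_widen_cond N predT (fun j => 'C(n, j)%:R *
     (wsum (only P x) j F * wsum (only (predC P) x) (n - j) G))) //= mulr_sumr.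
  apply: eq_big => j; first by rewrite ltnS.
  move=> jn'; have jn : (j <= n)%N by [].
  rewrite /a /b -(bin_fact jn) !natrM.
  have := fact_gt0 j; have := fact_gt0 (n - j); have : (0 < 'C(n, j))%N by rewrite bin_gt0.
  rewrite -!(ltr_nat R) => C0 f1 f2; field.
  by rewrite !gt_eqF.
rewrite (exchange_big_dep predT) //= mulr_suml; apply: ler_sum => j _.
rewrite -mulr_sumr ler_wpM2l //.
rewrite -(big_geq_mkord j N predT (fun n => b (n - j)%N)).
have -> : \sum_(j <= n < N) b (n - j)%N = \sum_(0 <= i < N - j) b i.
  by rewrite -{1}[nat_of_ord j]add0n big_addn; apply: eq_bigr => i _; rewrite addnK.
rewrite -[leRHS](big_mkord predT b) (big_cat_nat (leq0n (N - j)) (leq_subr _ _)) /=.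
by rewrite lerDl sumr_ge0.
Qed.

(** Poisson thinning: subwords of letters with different keys are independent, up to truncation. One
    key is split off at a time. *)
Lemma psum_prod_le (I : eqType) (key : A -> I) x (psi : I -> seq A -> R) N s :
  uniq s -> (forall a, 0 <= x a) -> (forall i c, 0 <= psi i c) ->
  psum (only (fun a => key a \in s) x) N
    (fun c => \prod_(i <- s) psi i [seq a <- c | key a == i]) <=
  \prod_(i <- s) psum (only (fun a => key a == i) x) N (psi i).
Proof.
move=> + x0 psi0; elim: s => [_|i s IH /= /andP[nis us]].
  rewrite big_nil (eq_psum (F := _) (G := fun=> 1) N (fun=> erefl)) => [|c]; last by rewrite big_nil.
  rewrite /psum; case: N => [|N]; first by rewrite big_ord0 ler01.
  rewrite big_ord_recl big1 => [|j _] /=; first by rewrite invr1 mulr1 addr0.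
  by rewrite big1 ?mulr0 // => a _; rewrite /only mul0r.
have only0 y Q a : (forall a, 0 <= y a) -> 0 <= only Q y a by rewrite /only; case: ifP.
rewrite big_cons.
set P := fun a => key a == i.
pose G c := \prod_(j <- s) psi j [seq a <- c | key a == j].
have G0 c : 0 <= G c by exact: prodr_ge0.
apply: (@le_trans _ _ (psum (only (fun a => key a \in i :: s) x) N
   (fun c => psi i (seq.filter P c) * G (seq.filter (predC P) c)))).
  rewrite le_eqVlt; apply/orP; left; apply/eqP; apply: eq_psum => // c.
  rewrite big_cons; congr (_ * _); apply: eq_big_seq => j js.
  congr psi; rewrite -filter_predI; apply: eq_filter => a /=.
  rewrite /P; case: eqP => //= ->; apply/esym/negP => /eqP ji.
  by rewrite -ji js in nis.
apply: le_trans (psum_split_le _ _ _ _ _) _ => // [a|]; first exact: only0.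
have -> : psum (only P (only (fun a => key a \in i :: s) x)) N (psi i) =
          psum (only P x) N (psi i).
  by apply: eq_psum => // a; rewrite /only /P inE; case: eqP.
rewrite ler_wpM2l ?psum_ge0 // => [a|]; first exact: only0.
apply: le_trans (IH us).
rewrite le_eqVlt; apply/orP; left; apply/eqP; apply: eq_psum => // a.
rewrite /only /P /= inE; case: eqP => //= ->.
by rewrite (negbTE nis).
Qed.

End WordSum.

Section Flags.
Variables (R : realFieldType) (B : finType).

Definition win (d : seq (bool * B)) := [seq a.2 | a <- d & a.1].
Definition out (d : seq (bool * B)) := [seq a.2 | a <- d & ~~ a.1].

(* Merging the two flagged classes reproduces the word of total mass [lam + mu];
   the reversal, harmless by exchangeability, makes each letter extend an end. *)
Lemma wsum_flags (lam mu : R) (x : B -> R) n F :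
  wsum (fun a : bool * B => (if a.1 then lam else mu) * x a.2) n
    (fun d => F (win d ++ rev (out d))) = (lam + mu) ^+ n * wsum x n F.
Proof.
elim: n F => [|n IH] F; first by rewrite /= expr0 mul1r.
rewrite [LHS]/= sum_flags exprS mulrDl mulrDl; congr (_ + _).
  rewrite -mulrA [wsum x n.+1 F]/= !mulr_sumr; apply: eq_bigr => b _.
  rewrite -[X in _ * X = _]/(wsum _ n (fun d => F (b :: (win d ++ rev (out d))))).
  by rewrite (IH (fun c => F (b :: c))) /=; ring.
rewrite -mulrA wsum_rcons !mulr_sumr; apply: eq_bigr => b _.
rewrite (eq_wsum n (G := fun d => F (rcons (win d ++ rev (out d)) b)) (fun=> erefl)).
  by rewrite (IH (fun c => F (rcons c b))) /=; ring.
by move=> d; rewrite /win /out /= rev_cons rcons_cat.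
Qed.

End Flags.

(** * The law of the edge types *)

Section LinkTypes.
Variable R : realType.

(** The difference of the two exponential series has nonnegative terms. *)
Lemma exp_partial_le (a b : R) N : 0 <= a <= b ->
  \sum_(n < N) (n`!%:R)^-1 * (b ^+ n - a ^+ n) <= expR b - expR a.
Proof.
move=> /andP[a0 ab].
pose v := (series (exp_coeff b) - series (exp_coeff a))%R.
have vE m : v m = \sum_(n < m) (n`!%:R)^-1 * (b ^+ n - a ^+ n).
  rewrite (_ : v m = series (exp_coeff b) m - series (exp_coeff a) m) //.
  rewrite /series /= !big_mkord -sumrB.
  by apply: eq_bigr => n _; rewrite /exp_coeff /=; ring.
have vcvg : (v @ \oo --> expR b - expR a)%classic.
  by apply: cvgB; exact: is_cvg_series_exp_coeff.
rewrite -vE -(cvg_lim (@Rhausdorff R) vcvg).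
apply: nondecreasing_cvgn_le; last by apply/cvg_ex; exists (expR b - expR a).
apply/nondecreasing_seqP => m; rewrite !vE big_ord_recr /= lerDl.
by rewrite mulr_ge0 ?invr_ge0 // subr_ge0 lerXn2r // nnegrE ?(le_trans a0).
Qed.

Local Notation Zt := (false, false).
Local Notation Dt := (true, false).
Local Notation Gt := (false, true).
Local Notation Bt := (true, true).

Variable I : finType.
Implicit Types (d : seq (bool * (I * bool))).

Definition link_type d : bool * bool :=
  let W := [seq l.2 | l <- win d] in
  (W != [::], (out d != [::]) || (W != [::]) && (W != [:: true; true])).

Definition edge_links d i := [seq l <- d | l.2.1 == i].

Definition link_types d : {ffun I -> bool * bool} :=
  [ffun i => link_type (edge_links d i)].

Lemma size_win_out d : (size (win d) + size (out d))%N = size d.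
Proof. by rewrite !size_map !size_filter -(count_predC (fun a => a.1)). Qed.

(** [Zt], [Gt] and [Dt] are put as a condition on the length and one on each letter separately, the
    shape summed by [wsum_all]; [Bt] is obtained by subtraction. *)
Lemma link_typeZ d : (link_type d == Zt) = (size d == 0)%N && all predT d.
Proof.
rewrite all_predT andbT; case: d => [//|l d]; apply/negbTE.
by rewrite /link_type xpair_eqE; case: l => [[] b] /=; rewrite ?andbF.
Qed.

Lemma link_typeG d :
  (link_type d == Gt) = (size d != 0)%N && all (fun a => ~~ a.1) d.
Proof.
have nW : ([seq l.2 | l <- win d] == [::]) = all (fun a => ~~ a.1) d.
  by elim: d => // -[[] b] d.
rewrite -size_win_out /link_type xpair_eqE; case dall: (all _ _); rewrite dall in nW.
  by move: nW; case: (win d) => //= _; rewrite orbF andbT eqb_id -size_eq0.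
by rewrite nW andbF.
Qed.

Lemma link_typeD d :
  (link_type d == Dt) = (size d == 2)%N && all (fun a => a.1 && a.2.2) d.
Proof.
case: (boolP (size d == 2)%N) => [|nd].
  by case: d => [|[f1 [i1 s1]] [|[f2 [i2 s2]] []]] // _; case: f1; case: f2; case: s1; case: s2.
apply/negP; rewrite /link_type xpair_eqE => /andP[/eqP W0 /eqP].
move/negbT; rewrite negb_or negbK W0 /= negbK => /andP[/eqP o /eqP W2].
by move: nd; rewrite -size_win_out o addn0 -(size_map (fun l => l.2)) W2.
Qed.

Variables (lam mu u : R).
Hypotheses (lam_ge0 : 0 <= lam) (mu_ge0 : 0 <= mu) (u01 : 0 <= u <= 1).

Definition link_weight (l : bool * (I * bool)) : R :=
  (if l.1 then lam else mu) * (if l.2.2 then u else 1 - u).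

(** Law of the type of an edge with independent Poisson numbers of links, of mean [lam] in the
    window and [mu] outside, each a cross with probability [u]. The last weight is the probability
    of a window link minus that of [Dt]. *)
Definition type_weight (a : bool * bool) : R :=
  let e := expR (- (lam + mu)) in
  match a with
  | (false, false) => e
  | (true, false) => e * ((lam * u) ^+ 2 / 2)
  | (false, true) => e * (expR mu - 1)
  | (true, true) => e * (expR (lam + mu) - expR mu - (lam * u) ^+ 2 / 2)
  end.

Lemma link_weight_ge0 l : 0 <= link_weight l.
Proof. by move: u01 => /andP[u0 u1]; rewrite /link_weight mulr_ge0 //; case: ifP => // _; lra. Qed.

Lemma sum_type_weight : \sum_a type_weight a = 1.
Proof.
rewrite sum_types /type_weight -[RHS](@expRxMexpNx_1 R (lam + mu)); ring.
Qed.

Section OneEdge.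
Variable i : I.
Let y := only (fun l : bool * (I * bool) => l.2.1 == i) link_weight.

Lemma edge_weight_ge0 l : 0 <= y l.
Proof. by rewrite /y /only; case: ifP => // _; exact: link_weight_ge0. Qed.

Lemma sum_edge_weight (P : pred (bool * (I * bool))) :
  \sum_(l | P l) y l =
  (if P (true, (i, true)) then lam * u else 0) +
  (if P (true, (i, false)) then lam * (1 - u) else 0) +
  (if P (false, (i, true)) then mu * u else 0) +
  (if P (false, (i, false)) then mu * (1 - u) else 0).
Proof.
have E (g : I * bool -> R) : (forall j s, j != i -> g (j, s) = 0) ->
    \sum_b g b = g (i, true) + g (i, false).
  move=> g0; rewrite (eq_bigr (fun p => g (p.1, p.2))) => [|[? ?] //].
  rewrite -(pair_bigA _ (fun j s => g (j, s))) /= (bigD1 i) //= big_bool /=.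
  by rewrite big1 ?addr0 // => j ji; rewrite big_bool /= !g0 // addr0.
rewrite big_mkcond sum_flags !E /= => [|j s ji|j s ji]; try
  by rewrite /y /only /= (negbTE ji); case: ifP.
by rewrite /y /only /= eqxx /link_weight /= addrA.
Qed.

Let pt N a := psum y N (fun d => (link_type d == a)%:R).

Lemma psum_all N (g : nat -> bool) P :
  psum y N (fun d => (g (size d) && all P d)%:R) =
  \sum_(n < N) (n`!%:R)^-1 * ((g n)%:R * (\sum_(l | P l) y l) ^+ n).
Proof.
apply: eq_bigr => n _; rewrite -(wsum_all y n (fun m => (g m)%:R)); congr (_ * _).
by apply: eq_wsum => // d; rewrite -natrM mulnb.
Qed.

(** With three more terms the lengths 0, 1 and 2 are all counted, so the sums for [Zt] and [Dt]
    become exact. *)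
Lemma psum_le_add3 N F : (forall c, 0 <= F c) -> psum y N F <= psum y N.+3 F.
Proof.
move=> F0; rewrite /psum !big_ord_recr /= -!addrA lerDl.
by rewrite !addr_ge0 // mulr_ge0 ?invr_ge0 // (wsum_ge0 N edge_weight_ge0 F0,
  wsum_ge0 N.+1 edge_weight_ge0 F0, wsum_ge0 N.+2 edge_weight_ge0 F0).
Qed.

Lemma type_psumZ N : pt N.+3 Zt = 1.
Proof.
rewrite /pt; under eq_psum => [l|d]; [over|rewrite link_typeZ; over|].
rewrite (psum_all _ (fun m => m == 0)%N) sum_edge_weight big_ord_recl /= big1 => [|j _].
  by rewrite invr1 !mul1r expr0 addr0.
by rewrite mul0r mulr0.
Qed.

Lemma type_psumD N : pt N.+3 Dt = (lam * u) ^+ 2 / 2.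
Proof.
rewrite /pt; under eq_psum => [l|d]; [over|rewrite link_typeD; over|].
rewrite (psum_all _ (fun m => m == 2)%N) sum_edge_weight /= !addr0.
rewrite 3!big_ord_recl /= big1 => [|j _]; first by rewrite !mul0r !mulr0 mul1r addr0 !add0r mulrC.
by rewrite mul0r mulr0.
Qed.

Lemma type_psumG N : pt N Gt = \sum_(n < N) (n`!%:R)^-1 * (mu ^+ n - 0 ^+ n).
Proof.
rewrite /pt; under eq_psum => [l|d]; [over|rewrite link_typeG; over|].
rewrite (psum_all _ (fun m => m != 0)%N) sum_edge_weight /= !add0r.
apply: eq_bigr => -[[|n] /= _] _; first by rewrite !expr0 subrr mul0r.
by rewrite mul1r expr0n subr0 -mulrDr addrC subrK mulr1.
Qed.

Lemma type_psum_sum N : \sum_a pt N a = \sum_(n < N) (n`!%:R)^-1 * (lam + mu) ^+ n.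
Proof.
rewrite /pt -psum_sum.
have E : psum y N (fun d => \sum_a (link_type d == a)%:R) =
    psum y N (fun d => (predT (size d) && all predT d)%:R).
  apply: eq_psum => // d; rewrite all_predT /= (bigD1 (link_type d)) //= eqxx.
  by rewrite big1 ?addr0 // => a; rewrite eq_sym => /negbTE ->.
rewrite E psum_all sum_edge_weight /=; apply: eq_bigr => n _.
by rewrite mul1r; congr (_ * _ ^+ _); ring.
Qed.

Lemma type_psum_le N a : pt N a <= expR (lam + mu) * type_weight a.
Proof.
apply: le_trans (psum_le_add3 _ _) _ => //; rewrite -/(pt _ _).
have := expRxMexpNx_1 (lam + mu); set e' := expR (- _) => ee'.
have G_le : pt N.+3 Gt <= expR mu - 1.
  by rewrite type_psumG -[X in _ - X](expR0 R) exp_partial_le // lexx.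
have B_eq := type_psum_sum N.+3; rewrite sum_types type_psumZ type_psumD in B_eq.
(* The total minus the other three types: a truncated [expR (lam + mu) - expR mu], minus the exact
   term for [Dt]. *)
have B_le : pt N.+3 Bt <= expR (lam + mu) - expR mu - (lam * u) ^+ 2 / 2.
  have := @exp_partial_le mu (lam + mu) N.+3; rewrite mu_ge0 lerDr lam_ge0 => /(_ isT).
  under eq_bigr do rewrite mulrBr; rewrite sumrB -B_eq.
  have -> : pt N.+3 Gt = \sum_(n < N.+3) (n`!%:R)^-1 * mu ^+ n - 1.
    rewrite type_psumG; under eq_bigr do rewrite mulrBr; rewrite sumrB; congr (_ - _).
    rewrite big_ord_recl /= big1 => [|j _]; first by rewrite expr0 invr1 mulr1 addr0.
    by rewrite expr0n mulr0.
  by lra.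
rewrite /type_weight -/e'; case: a => [[] []]; rewrite ?(mulrA _ e') ee' ?mul1r //.
- by rewrite type_psumD.
- by rewrite type_psumZ.
Qed.

End OneEdge.

(** Having prescribed types is a product over edges of conditions on their subwords, so thinning
    bounds it by the one-edge laws; the exponential is the normalisation missing from [psum]. *)
Lemma link_types_psum_le (F : {ffun I -> bool * bool} -> R) N :
  (forall t, 0 <= F t) ->
  psum link_weight N (fun d => F (link_types d)) <=
  expR (lam + mu) ^+ #|I| * iid type_weight F.
Proof.
move=> F0.
have -> : psum link_weight N (fun d => F (link_types d)) =
    \sum_t F t * psum link_weight N (fun d =>
       \prod_(i <- index_enum I) (link_type (edge_links d i) == t i)%:R).
  under eq_bigr do rewrite -psumZ.
  rewrite -psum_sum; apply: eq_psum => // d; rewrite (bigD1 (link_types d)) //=.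
  rewrite big1 => [|i _]; last by rewrite ffunE eqxx.
  rewrite mulr1 big1 ?addr0 // => t tne.
  have /existsP[i ti] : [exists i, t i != link_types d i].
    rewrite -negb_forall; apply: contra tne => /forallP td.
    by apply/eqP/ffunP => i; exact/eqP.
  rewrite ffunE eq_sym in ti.
  by rewrite (bigD1 i) //= (negbTE ti) mul0r mulr0.
rewrite /iid mulr_sumr; apply: ler_sum => t _.
rewrite mulrA [leRHS]mulrC ler_wpM2l //.
rewrite -prodr_const -big_split /=.
apply: (@le_trans _ _ (psum (only (fun l : bool * (I * bool) => l.2.1 \in index_enum I) link_weight) N
   (fun d => \prod_(i <- index_enum I) (link_type [seq l <- d | l.2.1 == i] == t i)%:R))).
  rewrite le_eqVlt; apply/orP; left; apply/eqP; apply: eq_psum => // l.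
  by rewrite /only mem_index_enum.
apply: le_trans (@psum_prod_le _ _ _ (fun l : bool * (I * bool) => l.2.1) link_weight
  (fun i d => (link_type d == t i)%:R) N (index_enum I) _ _ _) _ => //.
- exact: index_enum_uniq.
- exact: link_weight_ge0.
apply: ler_prod => i _; rewrite type_psum_le andbT psum_ge0 // => l.
exact: edge_weight_ge0.
Qed.

End LinkTypes.

(** * Loops avoid blocked edges *)

Section Topology.
Variables (V : countType) (E : seq (V * V)).
Hypothesis E_irr : forall i, (tnth (in_tuple E) i).1 != (tnth (in_tuple E) i).2.
Notation k := (size E).
Notation ends i := (tnth (in_tuple E) i).

Definition incident (x : V) (i : 'I_k) := (x == (ends i).1) || (x == (ends i).2).

Definition other_end (x : V) (i : 'I_k) := if x == (ends i).1 then (ends i).2 else (ends i).1.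

Definition edge_nb : rel 'I_k := fun i j =>
  (i != j) && (incident (ends i).1 j || incident (ends i).2 j).

Lemma edge_nb_irr : irreflexive edge_nb.
Proof. by move=> i; rewrite /edge_nb eqxx. Qed.

Lemma edge_nb_sym : symmetric edge_nb.
Proof.
move=> i j; rewrite /edge_nb /incident eq_sym; congr (_ && _).
rewrite -!orbA ![_ == (ends j).1]eq_sym ![_ == (ends j).2]eq_sym.
by do 4 case: eqP.
Qed.

Lemma incident_nb x i j : incident x i -> incident x j -> i != j -> edge_nb i j.
Proof.
rewrite /edge_nb => xi xj ->; case/orP: xi => /eqP xe; rewrite -xe xj ?orbT //.
Qed.

Lemma incident_other x i : incident x i -> incident (other_end x i) i.
Proof. by rewrite /incident /other_end; case: (x == _) => _; rewrite eqxx ?orbT. Qed.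

Lemma other_endK x i : incident x i -> other_end (other_end x i) i = x.
Proof.
rewrite /incident /other_end; case: (eqVneq x (ends i).1) => /= [->|_ /eqP ->].
  by rewrite eq_sym (negbTE (E_irr i)).
by rewrite eqxx.
Qed.

Variable d : seq (bool * ('I_k * bool)).
(** The word formed in [wsum_flags]: window links come first, so the window is an initial stretch of
    the time circle. *)
Let c1 := win d.
Let c2 := rev (out d).
Let c := c1 ++ c2.
Let X := opened edge_nb (link_types d).

(** Edges without links are closed too, but no trajectory jumps along them. *)
Definition blocked i := ~~ X i && (i \in [seq l.1 | l <- c]).

Lemma win_edge_links i : win (edge_links d i) = [seq l <- win d | l.1 == i].
Proof.
rewrite /win /edge_links -filter_predI filter_map -filter_predI.
by congr map; apply: eq_filter => l /=; rewrite andbC.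
Qed.

Lemma out_edge_links i : out (edge_links d i) = [seq l <- out d | l.1 == i].
Proof.
rewrite /out /edge_links -filter_predI filter_map -filter_predI.
by congr map; apply: eq_filter => l /=; rewrite andbC.
Qed.

Lemma mem_keys (s : seq ('I_k * bool)) i :
  (i \in [seq l.1 | l <- s]) = ([seq l <- s | l.1 == i] != [::]).
Proof.
elim: s => //= l s IH; rewrite inE IH eq_sym.
by case: eqP.
Qed.

Lemma blockedP i : blocked i ->
  [/\ [seq l.2 | l <- c1 & l.1 == i] = [:: true; true],
      i \notin [seq l.1 | l <- c2] &
      forall j, edge_nb i j -> j \notin [seq l.1 | l <- c1]].
Proof.
rewrite /blocked /X openedE /c map_cat mem_cat negb_or -andbA => /and3P[].
rewrite {1 2}[link_types d i]ffunE /link_type win_edge_links out_edge_links -/c1 /=.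
set W := [seq l.2 | l <- _].
have WE : (i \in [seq l.1 | l <- c1]) = (W != [::]).
  by rewrite mem_keys /W; case: [seq _ <- _ | _].
have c2E : (i \in [seq l.1 | l <- c2]) = ([seq l <- out d | l.1 == i] != [::]).
  by rewrite -mem_keys /c2 map_rev mem_rev.
rewrite negb_or negbK WE c2E => /andP[/eqP -> W2] nnb; rewrite eqxx orbF => Wn.
move: W2 nnb; rewrite Wn /= negbK => /eqP W2 /existsPn nnb; split => // j ij.
have := nnb j; rewrite ij /= ffunE /link_type win_edge_links /= negbK.
by rewrite mem_keys negbK; case: [seq _ <- _ | _].
Qed.

Definition cnt i j := count (fun l => l.1 == i) (take j c).

Definition pocket x j i := [&& blocked i, incident x i & odd (cnt i j)].

(* Between the two crosses of a blocked edge the trajectory is on the wrong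
   endpoint; [base] swaps it back, and its open cluster is invariant along loops. *)
Definition base x j := if [pick i | pocket x j i] is Some i then other_end x i else x.

(** A blocked edge has window links, which excludes blocked neighbours; hence the choice in [base]
    is unambiguous. *)
Lemma blocked_unique x i j : blocked i -> blocked j -> incident x i -> incident x j -> i = j.
Proof.
move=> bi bj xi xj; apply/eqP; apply: contraT => ij.
have [_ _ /(_ _ (incident_nb xi xj ij))] := blockedP bi.
have [Wj _ _] := blockedP bj.
by rewrite mem_keys negbK => /eqP c1j; rewrite c1j in Wj.
Qed.

Lemma base_pocket x j i : pocket x j i -> base x j = other_end x i.
Proof.
rewrite /base => pi; case: pickP => [i' pi'|/(_ i)]; last by rewrite pi.
case/and3P: pi => bi xi _; case/and3P: pi' => bi' xi' _.
by rewrite (blocked_unique bi' bi xi' xi).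
Qed.

Lemma base_free x j : (forall i, ~~ pocket x j i) -> base x j = x.
Proof. by rewrite /base => np; case: pickP => // i; rewrite (negbTE (np i)). Qed.

(** Past the window both crosses have been counted, so the parity is even. *)
Lemma pocket_lt x j i : pocket x j i -> (j < size c1)%N.
Proof.
case/and3P => /blockedP[c1i c2i _] _ odd_i; rewrite ltnNge; apply/negP => le_j.
move: odd_i; rewrite /cnt /c take_cat ltnNge le_j /= count_cat.
rewrite -size_filter -(size_map (fun l => l.2)) c1i.
rewrite (_ : count _ _ = 0)%N //; apply/eqP; rewrite -leqn0.
apply: leq_trans (_ : count (fun l => l.1 == i) c2 <= 0)%N.
  by rewrite -[c2 in leqRHS](cat_take_drop (j - size c1)) count_cat leq_addr.
by rewrite -size_filter leqn0 size_eq0; move: c2i; rewrite mem_keys negbK.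
Qed.

Section Link.
Variables (m : nat) (i : 'I_k) (s : bool).
Hypotheses (m_lt : (m < size c)%N) (c_m : forall l0, nth l0 c m = (i, s)).

Lemma cntS i' : cnt i' m.+1 = (cnt i' m + (i == i'))%N.
Proof.
rewrite /cnt (take_nth (i, s)) // -cats1 count_cat /= c_m /= addn0.
by rewrite eq_sym.
Qed.

Lemma mem_link : i \in [seq l.1 | l <- c].
Proof. by apply/mapP; exists (i, s) => //; rewrite -(c_m (i, s)) mem_nth. Qed.

Lemma mem_link1 : (m < size c1)%N -> i \in [seq l.1 | l <- c1].
Proof.
move=> m1; apply/mapP; exists (i, s) => //.
by rewrite -(c_m (i, s)) /c nth_cat m1 mem_nth.
Qed.

Lemma base_pass x : ~~ incident x i -> base x m = base x m.+1.
Proof.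
move=> nxi; rewrite /base; congr (match _ with Some _ => _ | None => _ end).
apply: eq_pick => i'; rewrite /pocket cntS.
by case: (eqVneq i i') => [<-|_]; rewrite ?addn0 // (negbTE nxi) !andbF.
Qed.

(** A pocket lies inside the window, so link [m] would be a window link on an edge adjacent to a
    blocked one. *)
Lemma base_open x j : incident x i -> ~~ blocked i -> (m <= j <= m.+1)%N -> base x j = x.
Proof.
move=> xi nbi /andP[mj jm]; apply: base_free => i'; apply/negP => pi'.
have m1 := leq_ltn_trans mj (pocket_lt pi').
case/and3P: pi' => bi' xi' _; have [_ _ nob] := blockedP bi'.
have /nob : edge_nb i' i.
  by apply: incident_nb xi' xi _; apply: contraNneq nbi => <-.
by rewrite mem_link1.
Qed.

(** The link changes the endpoint and the parity at once. *)
Lemma base_blocked x : incident x i -> blocked i ->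
  base x m = base (other_end x i) m.+1.
Proof.
move=> xi bi; have yi := incident_other xi; case: (boolP (odd (cnt i m))) => par.
  rewrite (@base_pocket x m i) ?base_free // => [i'|]; last by rewrite /pocket bi xi.
  apply/negP => /and3P[bi' yi']; rewrite (blocked_unique bi' bi yi' yi).
  by rewrite cntS eqxx addn1 /= par.
rewrite (@base_pocket (other_end x i) m.+1 i) ?base_free ?other_endK // => [i'|].
  apply/negP => /and3P[bi' xi']; rewrite (blocked_unique bi' bi xi' xi).
  by rewrite (negbTE par).
by rewrite /pocket bi yi cntS eqxx addn1 /= par.
Qed.

Lemma blocked_cross : blocked i -> s.
Proof.
move=> bi; have [c1i c2i _] := blockedP bi.
have m1 : (m < size c1)%N.
  rewrite ltnNge; apply: contra c2i => m1; apply/mapP; exists (i, s) => //.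
  rewrite -(c_m (i, s)) /c nth_cat ltnNge m1 /= mem_nth //.
  by rewrite ltn_subLR // -size_cat.
have : s \in [seq l.2 | l <- c1 & l.1 == i].
  apply/mapP; exists (i, s) => //; rewrite mem_filter eqxx /=.
  by rewrite -(c_m (i, s)) /c nth_cat m1 mem_nth.
by rewrite c1i !inE orbb => /eqP ->.
Qed.

End Link.

Definition joined v w := exists q, path (open_adj X) v q /\ last v q = w.

Lemma joined_trans v x w : joined v x -> joined x w -> joined v w.
Proof.
move=> [p [pv px]] [q [qx qw]]; exists (p ++ q).
by rewrite cat_path last_cat pv px.
Qed.

Lemma joined_other x i : X i -> incident x i -> joined x (other_end x i).
Proof.
move=> Xi xi; exists [:: other_end x i]; split => //=; rewrite andbT.
apply/existsP; exists i; rewrite Xi /other_end /=.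
case: (eqVneq x (ends i).1) => [->|xn]; first by rewrite -surjective_pairing eqxx.
by move: xi; rewrite /incident (negbTE xn) => /eqP ->; rewrite -surjective_pairing eqxx orbT.
Qed.

Lemma link_at m : (m < size c)%N ->
  exists i s, (forall z, nth z (links c) m = (ends i, s)) /\ (forall l0, nth l0 c m = (i, s)).
Proof.
case E0: c => [//|l0 c']; rewrite -E0 => mc.
exists (nth l0 c m).1, (nth l0 c m).2; split => z.
  by rewrite /links (nth_map l0).
by rewrite (set_nth_default l0) // -surjective_pairing.
Qed.

(** The base stays put at time 0, at links elsewhere and at blocked edges; every other link sits on
    an open edge, along which the base moves. *)
Lemma loop_step_base x j up : (j <= size c)%N ->
  let s := loop_step (links c) (x, j, up) in
  (s.1.2 <= size c)%N /\ joined (base x j) (base s.1.1 s.1.2).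
Proof.
have joined_refl y : joined y y by exists [::].
(* No pocket contains time 0, whose two sides are the arcs [0] and [size c]. *)
have base_end y j' : (j' == 0)%N || (j' == size c)%N -> base y j' = y.
  move=> j'E; apply: base_free => i; apply/negP => pi; move: (pocket_lt pi).
  case/orP: j'E => /eqP j'E; last by rewrite j'E /c size_cat ltnNge leq_addr.
  by move: pi; rewrite /pocket j'E /cnt take0 !andbF.
have sz : size (links c) = size c by rewrite size_map.
move=> jc; rewrite /loop_step sz; case: up.
  case: ltnP => [jlt|cj]; last first.
    have -> : j = size c by apply/eqP; rewrite eqn_leq jc.
    by rewrite /= !base_end ?eqxx ?orbT.
  have [i [s [-> c_j]]] := link_at jlt.
  case ei: (ends i) => [a b].
  have xE : (x == a) || (x == b) = incident x i by rewrite /incident ei.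
  have yE : (if x == a then b else a) = other_end x i by rewrite /other_end ei.
  rewrite xE yE; case: ifP => xi; last first.
    by rewrite /= -(base_pass jlt c_j) ?xi.
  have yi := incident_other xi.
  case: (boolP (blocked i)) => bi.
    rewrite (blocked_cross jlt c_j bi) /=; split => //.
    by rewrite (base_blocked jlt c_j xi bi).
  have Xi : X i.
    by move: bi; rewrite /blocked (mem_link jlt c_j) andbT negbK.
  rewrite (base_open c_j xi bi) ?leqnn ?leqnSn //.
  case: s c_j => c_j /=; split=> //; rewrite (base_open c_j yi bi) ?leqnn ?leqnSn //;
    exact: joined_other.
case: ltnP => [j0|]; last first.
  rewrite leqn0 => /eqP ->.
  by rewrite /= !base_end ?eqxx ?orbT.
(* Going down from arc [m.+1] meets the link of index [m]; the two arcs exchange roles. *)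
case: j j0 jc => // m _ mlt; rewrite succnK.
have [i [s [-> c_m]]] := link_at mlt.
case ei: (ends i) => [a b].
have xE : (x == a) || (x == b) = incident x i by rewrite /incident ei.
have yE : (if x == a then b else a) = other_end x i by rewrite /other_end ei.
rewrite xE yE; case: ifP => xi; last first.
  by rewrite /= -(base_pass mlt c_m) ?xi //; split => //; exact: ltnW.
have yi := incident_other xi.
case: (boolP (blocked i)) => bi.
  rewrite (blocked_cross mlt c_m bi) /=; split; first exact: ltnW.
  by rewrite (base_blocked mlt c_m yi bi) other_endK.
have Xi : X i.
  by move: bi; rewrite /blocked (mem_link mlt c_m) andbT negbK.
rewrite (base_open c_m xi bi) ?leqnn ?leqnSn //.
case: s c_m => c_m /=; split=> //; try exact: ltnW;
  rewrite (base_open c_m yi bi) ?leqnn ?leqnSn //; exact: joined_other.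
Qed.

Lemma same_loop_joined v w : same_loop (links c) v w -> joined v w.
Proof.
move=> [t /=]; set s := iter t _ _ => -[sw s0].
have base0 y : base y 0 = y.
  by apply: base_free => i; rewrite /pocket /cnt take0 !andbF.
have [_] : (s.1.2 <= size c)%N /\ joined v (base s.1.1 s.1.2).
  rewrite /s; elim: t {s sw s0} => [|t [IH1 IH2]] /=.
    by rewrite base0; split => //; exists [::].
  case: (iter t _ _) IH1 IH2 => [[x j] up] /= IH1 IH2.
  have [h1 h2] := loop_step_base x up IH1; split => //.
  exact: joined_trans IH2 h2.
by rewrite sw s0 base0.
Qed.

End Topology.

(** * Estimates *)

Section Numerics.
Variable R : realType.
Implicit Types (r s beta u : R).

Lemma bernoulli_sub s m : 0 <= s <= 1 -> 1 - m%:R * s <= (1 - s) ^+ m.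
Proof.
move=> /andP[s0 s1]; elim: m => [|m IH]; first by rewrite mul0r subr0 expr0.
rewrite exprS; apply: le_trans (_ : (1 - s) * (1 - m%:R * s) <= _); last first.
  by rewrite ler_wpM2l // subr_ge0.
have : 0 <= (m%:R : R) by []; rewrite -natr1; nra.
Qed.

Lemma bernoulli_add r m : 0 <= r -> (1 + r) ^+ m * (1 - m%:R * r) <= 1.
Proof.
move=> r0; elim: m => [|m IH]; first by rewrite mul0r subr0 expr0 mulr1.
apply: le_trans IH; rewrite exprSr -mulrA ler_wpM2l ?exprn_ge0 ?addr_ge0 //.
have : 0 <= (m%:R : R) by []; rewrite -natr1; nra.
Qed.

(** The square of [h <= sinh h] at [h = beta / 2], multiplied by [4 * expR (- beta)]. *)
Lemma sinh_ge beta : 0 < beta -> beta ^+ 2 * expR (- beta) <= (1 - expR (- beta)) ^+ 2.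
Proof.
move=> b0; pose h := beta / 2; have h0 : 0 < h by rewrite divr_gt0.
have hE : beta = h + h by rewrite /h; lra.
have y_ge : 1 + h + h ^+ 2 / 2 <= expR h.
  have := @exp_partial_le R 0 h 3; rewrite lexx ltW // => /(_ isT).
  rewrite !big_ord_recl big_ord0 /= expR0 !expr0n /= !subr0 expr0 subrr mulr0.
  rewrite -[(bump 0 0)`!]/1%N -[(bump 0 (bump 0 0))`!]/2%N /bump /= invr1 mul1r expr1.
  by rewrite addr0 add0r mulrC; lra.
have yE := expRxMexpNx_1 h; set y := expR h in y_ge yE; set z := expR (- h) in yE.
have y0 : 0 < y by exact: expR_gt0.
have z0 : 0 < z by exact: expR_gt0.
have -> : expR (- beta) = z * z by rewrite hE opprD expRD.
have key : 2 * h * z <= 1 - z * z.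
  (* By [y_ge], [(y - h) ^+ 2 >= (1 + h ^+ 2 / 2) ^+ 2 >= 1 + h ^+ 2]. *)
  have : 2 * h * y <= y * y - 1 by nra.
  have -> : z = y^-1 by apply: (mulfI (lt0r_neq0 y0)); rewrite yE mulfV ?lt0r_neq0.
  move=> H; rewrite -(ler_pM2r y0) -(ler_pM2r y0).
  have -> : 2 * h * y^-1 * y * y = 2 * h * y by field; exact: lt0r_neq0.
  by have -> : (1 - y^-1 * y^-1) * y * y = y * y - 1 by field; exact: lt0r_neq0.
have -> : beta ^+ 2 * (z * z) = (2 * h * z) ^+ 2 by rewrite hE; ring.
by rewrite lerXn2r // nnegrE; [rewrite !mulr_ge0 // ltW | apply: le_trans key; rewrite !mulr_ge0 // ltW].
Qed.

(** The right side is a quarter of a lower bound for the weight of [Dt] when a window link has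
    probability [p / (6 * K)]. For [rho = beta / (expR beta - 1)], [sinh_ge] gives both
    [beta * rho <= p] and [rho ^+ 2 <= expR (- beta)], so three factors [rho] suffice. *)
Lemma delta_bound (K : nat) beta u :
  (2 <= K)%N -> 0 < beta ->
  let p := 1 - expR (- beta) in
  p * delta K beta u <= ((1 - p) * (p * (6 * K%:R)^-1 * u) ^+ 2 / 2) / 4.
Proof.
move=> K2 b0 /=; set e := expR (- beta); set p := 1 - e.
have e0 : 0 < e by exact: expR_gt0.
have e1 : e < 1 by rewrite /e expR_lt1; lra.
have p0 : 0 < p by rewrite /p; lra.
have K0 : 0 < (K%:R : R) by rewrite ltr0n; lia.
have eE : expR beta - 1 = p / e.
  apply: (mulIf (lt0r_neq0 e0)); rewrite mulrBl expRxMexpNx_1 mul1r -/e.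
  by rewrite divfK ?lt0r_neq0.
pose rho := beta * e / p.
have rho0 : 0 < rho by rewrite divr_gt0 // mulr_gt0.
have rho1 : rho <= 1.
  rewrite ler_pdivrMr // mul1r /p.
  have := expR_ge1Dx beta; have := expRxMexpNx_1 beta; rewrite -/e; nra.
have sh : beta ^+ 2 * e <= p ^+ 2 by exact: sinh_ge.
have rhoE : beta / (p / e) = rho by rewrite invf_div mulrA.
rewrite /delta eE rhoE.
have rhoK : rho ^+ (2 * K).-1 <= rho ^+ 3.
  by apply: ler_wiXn2l => //; [exact: ltW | lia].
have M_ge : 192 <= 3 * 4 ^+ K.+1 :> R.
  have : (4 : R) ^+ 3 <= 4 ^+ K.+1 by rewrite ler_weXn2l //; lra.
  by rewrite !exprS expr0; lra.
set M := 3 * 4 ^+ K.+1 in M_ge *.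
have bM : beta / (beta + M) <= beta / 192 by rewrite ler_pM2l // lef_pV2 ?posrE; lra.
(* [144] is [4 * 6 ^+ 2], from the quarter and the square of the window fraction. *)
have main : beta / (beta + M) * rho ^+ (2 * K).-1 <= e * p / 144.
  apply: (@le_trans _ _ (beta / 192 * rho ^+ 3)).
    by apply: ler_pM => //; [rewrite divr_ge0 // ltW //; lra | rewrite exprn_ge0 // ltW].
  have br : (beta * rho) <= p.
    by rewrite /rho mulrA ler_pdivrMr // mulrA -!expr2.
  have -> : beta / 192 * rho ^+ 3 = (beta * rho) * (rho * rho) / 192 by field.
  have : (beta * rho) * (rho * rho) <= p * (rho * rho).
    by rewrite ler_wpM2r // mulr_ge0 // ltW.
  have : p * (rho * rho) <= e * p.
    have -> : p * (rho * rho) = (beta ^+ 2 * e) / p ^+ 2 * (e * p).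
      by rewrite /rho; field; exact: lt0r_neq0.
    by apply: ler_piMl; [rewrite mulr_ge0 // ltW | rewrite ler_pdivrMr ?exprn_gt0 // mul1r].
  have : 0 <= e * p by rewrite mulr_ge0 // ltW.
  lra.
have -> : p * (2^-1 * (u / K%:R) ^+ 2 * (beta / (beta + M)) * rho ^+ (2 * K).-1) =
  p * (u / K%:R) ^+ 2 / 2 * (beta / (beta + M) * rho ^+ (2 * K).-1) by field; lra.
apply: (@le_trans _ _ (p * (u / K%:R) ^+ 2 / 2 * (e * p / 144))).
  by rewrite ler_wpM2l // divr_ge0 // mulr_ge0 ?sqr_ge0 // ltW.
rewrite le_eqVlt; apply/orP; left; apply/eqP.
by rewrite /p; field; lra.
Qed.

(** [D] is the weight of [Dt]. The last three bounds make merging [Dt] into [Gt] cheap, leave a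
    nonnegative weight for [Bt], and allow [c = (1 - s)^-1] for clearing a closed edge. *)
Lemma blocked_weight_bounds e p s lam u :
  0 < e -> p = 1 - e -> 0 < p -> 0 < s -> s <= 1 / 12 -> 0 <= lam -> 0 <= u <= 1 ->
  lam * (1 - s) <= p * s ->
  let D := e * ((lam * u) ^+ 2 / 2) in
  [/\ 0 <= D, D <= p * (1 - s) * (s ^+ 2 / 6), D <= p * s & e + D <= (1 - s)^-1 * e].
Proof.
move=> e0 pE p0 s0 s12 lam0 /andP[u0 u1] /=; set D := e * _.
have t_ge : 11 / 12 <= 1 - s by lra.
set t := 1 - s in t_ge * => lt_ps.
have t0 : 0 < t by lra.
have t2 : 0 < t ^+ 2 by exact: exprn_gt0.
have D0 : 0 <= D by rewrite mulr_ge0 ?divr_ge0 ?sqr_ge0 // ltW.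
have D2 : 2 * (D * t ^+ 2) <= e * (p * s) ^+ 2.
  have -> : 2 * (D * t ^+ 2) = e * ((lam * t) ^+ 2 * u ^+ 2) by rewrite /D; field.
  rewrite ler_pM2l //; apply: (@le_trans _ _ ((lam * t) ^+ 2)).
    by rewrite ler_piMr ?sqr_ge0 // expr_le1.
  by rewrite lerXn2r // nnegrE mulr_ge0 // ltW.
have ps2 : 0 <= p * s ^+ 2 by rewrite mulr_ge0 ?sqr_ge0 // ltW.
have Dle : D <= p * t * (s ^+ 2 / 6).
  (* [e * p <= 1 / 4] bounds [D * t ^+ 2] by [p * s ^+ 2 / 8], and [(11 / 12) ^+ 3] exceeds
     [6 / 8]. *)
  rewrite -(ler_pM2r t2); apply: (@le_trans _ _ (p * s ^+ 2 / 8)).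
    have ep : e * p <= 1 / 4 by rewrite pE; have := sqr_ge0 (e - 1 / 2); rewrite expr2; lra.
    have {}ep := ler_wpM2r ps2 ep.
    by rewrite exprMn in D2; lra.
  have t3 : (11 / 12 : R) ^+ 3 <= t ^+ 3 by rewrite lerXn2r // nnegrE; lra.
  by have := ler_wpM2l ps2 t3; rewrite [(11 / 12) ^+ 3]exprS [(11 / 12) ^+ 2]expr2; lra.
split => //.
  apply: le_trans Dle _; rewrite -mulrA ler_wpM2l ?(ltW p0) //.
  have h1 : t * (s ^+ 2 / 6) <= 1 * (s ^+ 2 / 6).
    by rewrite ler_wpM2r ?divr_ge0 ?sqr_ge0 // /t; lra.
  have h2 : s * s <= 1 * s by rewrite ler_pM2r //; lra.
  by rewrite expr2 in h1 *; lra.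
rewrite mulrC ler_pdivlMr //.
suff : D * t <= e * s by rewrite /t; lra.
rewrite -(ler_pM2r t0).
have p1 : p <= 1 by lra.
have ss : (p * s) ^+ 2 <= s * t.
  apply: (@le_trans _ _ (s ^+ 2)); last by rewrite expr2 ler_pM2l // /t; lra.
  by rewrite lerXn2r ?nnegrE ?mulr_ge0 ?(ltW p0) ?(ltW s0) // ler_piMl // ltW.
have es : e * (p * s) ^+ 2 <= e * (s * t) by rewrite ler_pM2l.
have est : 0 <= e * (s * t) by rewrite !mulr_ge0 // ltW.
by rewrite expr2 in D2; lra.
Qed.

(** Without surgeries and blocking the two sides differ by [p - q], at most [D / 4]. The first
    surgery loses at most [D * (2 / 5)] and blocking gains at least [D * (65 / 100)], exactly the
    sum of the two. *)
Lemma surgery_cost (n : nat) (p s D q x : R) :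
  0 < p < 1 -> 0 < s -> s <= 1 / 12 -> n%:R * s <= 1 / 3 ->
  0 <= D -> D <= p * (1 - s) * (s ^+ 2 / 6) -> x <= D / 4 -> 0 <= q -> p - x <= q ->
  let r := D / (p * (1 - s)) in
  (1 - q) * (p * (1 - s) + p * s * (1 + r) ^+ n) <=
  q * (1 - p) + D / ((1 - s)^-1 ^+ n * (1 + r) ^+ (n * n)).
Proof.
move=> /andP[p0 p1] s0 s12 ns D0 Dle xD q0 xq /=; set r := D / _.
have G0 : 0 < p * (1 - s) by rewrite mulr_gt0 //; lra.
have r0 : 0 <= r by rewrite divr_ge0 // ltW.
have DE : D = r * (p * (1 - s)) by rewrite divfK // lt0r_neq0.
have r_le : r <= s ^+ 2 / 6 by rewrite ler_pdivrMr // mulrC.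
have n0 : 0 <= (n%:R : R) by [].
set N : R := n%:R in ns n0.
have nr : N * r <= 1 / 216.
  have : N * r <= N * (s ^+ 2 / 6) by rewrite ler_wpM2l.
  have : N * s * s <= 1 / 3 * (1 / 12) by rewrite ler_pM // ?mulr_ge0 // ltW.
  by rewrite expr2; lra.
have nnr : N * N * r <= 1 / 54.
  have : N * N * r <= N * N * (s ^+ 2 / 6) by rewrite ler_wpM2l // mulr_ge0.
  have : (N * s) * (N * s) <= 1 / 3 * (1 / 3) by rewrite ler_pM // mulr_ge0 // ltW.
  by rewrite expr2; lra.
have := @bernoulli_add r n r0; set a := (1 + r) ^+ n; rewrite -/N => a_le.
have a1 : 1 <= a by rewrite exprn_ege1 // lerDl.
have := @bernoulli_add r (n * n) r0; set b := (1 + r) ^+ (n * n); rewrite natrM -/N => b_le.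
have b0 : 0 < b by rewrite exprn_gt0 //; lra.
have := @bernoulli_sub s n; rewrite ltW //= -/N.
set g := (1 - s) ^+ n => /(_ ltac:(lra)) g_ge.
have g0 : 0 < g by rewrite exprn_gt0 //; lra.
have -> : D / ((1 - s)^-1 ^+ n * b) = D * (g / b).
  by rewrite exprVn -/g; field; rewrite !lt0r_neq0.
have gb : 65 / 100 <= g / b.
  rewrite ler_pdivlMr //; have : b * (53 / 54) <= 1.
    by apply: le_trans b_le; apply: ler_wpM2l; [exact: ltW | lra].
  by lra.
have Dgb : D * (65 / 100) <= D * (g / b) by rewrite ler_wpM2l.
have Ns0 : 0 <= N * s by rewrite mulr_ge0 // ltW.
have aN : a - 1 <= N * r * (216 / 215).
  have a2 : a <= 216 / 215.
    have : a * (215 / 216) <= 1.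
      by apply: le_trans a_le; apply: ler_wpM2l; lra.
    by lra.
  have : a * (N * r) <= 216 / 215 * (N * r) by rewrite ler_wpM2r // mulr_ge0.
  by lra.
have psa : p * s * (a - 1) <= D * (2 / 5).
  have h1 : p * s * (a - 1) <= p * s * (N * r * (216 / 215)).
    by rewrite ler_wpM2l // mulr_ge0 // ltW.
  have pr0 : 0 <= p * r by rewrite mulr_ge0 // ltW.
  have h2 : (p * r) * (N * s) <= (p * r) * (1 / 3) by rewrite ler_wpM2l.
  have h3 : (p * r) * (11 / 12) <= D by rewrite DE; have := ler_wpM2l pr0 s12; lra.
  by lra.
have pq : (1 - q) * (p * s * (a - 1)) <= p * s * (a - 1).
  apply: ler_piMl; last lra.
  by rewrite mulr_ge0 ?subr_ge0 // mulr_ge0 // ltW.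
by lra.
Qed.

End Numerics.

(** * Choice of the window *)

Section LinkDomination.
Variables (R : realType) (I : finType) (nb : rel I) (K : nat) (beta u q : R).
Hypotheses (nbC : symmetric nb) (nb_irr : irreflexive nb).
Hypothesis deg_nb : forall e, (#|nb e| <= 2 * K.-1)%N.
Hypotheses (K_ge2 : (2 <= K)%N) (beta_gt0 : 0 < beta) (u01 : 0 <= u <= 1).
Hypotheses (q01 : 0 <= q <= 1) (q_ge : (1 - expR (- beta)) * (1 - delta K beta u) <= q).

Lemma link_domination :
  exists lam mu, [/\ 0 <= lam, 0 <= mu, lam + mu = beta &
    forall f, increasing f ->
      iid (type_weight lam mu u) (f \o opened nb) <= iid (bern q) f].
Proof.
have b0 := beta_gt0; have qge := q_ge; have /andP[u0 u1] := u01; have /andP[q0 q1] := q01.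
set e := expR (- beta) in qge; set p := 1 - e in qge.
have e0 : 0 < e by exact: expR_gt0.
have e1 : e < 1 by rewrite /e expR_lt1; lra.
have pE : p = 1 - e by [].
have p0 : 0 < p by lra.
have K2 : 2 <= K%:R :> R by rewrite ler_nat.
(* This fraction keeps [n * s] below [1 / 3] for [n = 2 * (K - 1)], so the powers in the surgery
   costs are bounded uniformly in [K]. *)
pose s : R := (6 * K%:R)^-1.
have s0 : 0 < s by rewrite invr_gt0; lra.
have sK : s * K%:R = 1 / 6 by rewrite /s; field; lra.
have s12 : s <= 1 / 12 by have : 2 * s <= K%:R * s by [rewrite ler_wpM2r // ltW]; lra.
have ns : (2 * K.-1)%N%:R * s <= 1 / 3.
  have -> : ((2 * K.-1)%N%:R : R) = 2 * (K%:R - 1).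
    by rewrite natrM -subn1 natrB //; exact: ltnW K_ge2.
  by lra.
have ps0 : 0 < p * s by exact: mulr_gt0.
have ps_s : p * s <= s by rewrite ler_piMl //; [exact: ltW | lra].
(* An edge has a window link with probability [p * s]. *)
pose lam := - ln (1 - p * s).
have elam : expR (- lam) = 1 - p * s by rewrite opprK lnK // posrE; lra.
have lam_ge : p * s <= lam by have := expR_ge1Dx (- lam); lra.
have lam0 : 0 < lam by exact: lt_le_trans lam_ge.
have lam_le : lam * (1 - p * s) <= p * s.
  have h := expR_ge1Dx lam; have := expRxMexpNx_1 lam; rewrite elam.
  have : (1 + lam) * (1 - p * s) <= expR lam * (1 - p * s) by rewrite ler_wpM2r //; lra.
  lra.
have lt_ps : lam * (1 - s) <= p * s.
  by apply: le_trans lam_le; rewrite ler_wpM2l ?(ltW lam0) //; lra.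
pose mu := beta - lam.
have mu0 : 0 <= mu.
  rewrite subr_ge0 -lerN2 -(ler_expR (- beta)) elam -/e.
  by have : p * s <= p by [rewrite ler_piMr //; [exact: ltW | lra]]; lra.
have lm : lam + mu = beta by rewrite /mu; lra.
have emu : e * expR mu = 1 - p * s by rewrite -elam -expRD; congr expR; rewrite /mu; lra.
pose w := type_weight lam mu u.
have wZ : w (false, false) = e by rewrite /w /type_weight lm.
have wG : w (false, true) = p * (1 - s).
  by rewrite /w /type_weight lm -/e mulrBr emu; lra.
pose D := e * ((lam * u) ^+ 2 / 2).
have wD : w (true, false) = D by rewrite /w /type_weight lm.
have wB : w (true, true) = p * s - D.
  rewrite /w /type_weight lm -/e !mulrBr emu -/D.
  by rewrite [e * _]mulrC expRxMexpNx_1; lra.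
have [D0 Dle Dps Dc] := blocked_weight_bounds e0 pE p0 s0 s12 (ltW lam0) u01 lt_ps.
rewrite -/D in D0 Dle Dps Dc.
have xD : p * delta K beta u <= D / 4.
  have := delta_bound u K_ge2 b0; rewrite /= -/e -/p -/s => h; apply: le_trans h _.
  rewrite ler_pM2r ?invr_gt0 // /D [1 - p]subKr -mulrA ler_pM2l // ler_pM2r ?invr_gt0 //.
  by rewrite lerXn2r ?nnegrE ?mulr_ge0 // ?(ltW p0, ltW s0, ltW lam0) // ler_wpM2r.
have w0 a : 0 <= w a.
  by case: a => [[] []]; rewrite ?wZ ?wG ?wD ?wB //; try lra; rewrite mulr_ge0 // ltW //; lra.
exists lam, mu; split => //; first exact: ltW.
(* The types with a link have total weight [p], of which [Gt] has [p * (1 - s)]; this gives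
   [c = (1 - s)^-1]. [r] is the ratio of the weights of [Dt] and [Gt]. *)
move=> f; apply: (@opened_domination R I nb (2 * K.-1) nbC nb_irr deg_nb w q
  (D / (p * (1 - s))) (1 - s)^-1) => //.
- exact: sum_type_weight.
- by rewrite divr_ge0 // mulr_ge0 //; lra.
- by rewrite invf_ge1; lra.
- by rewrite wD wG divfK // lt0r_neq0 // mulr_gt0 //; lra.
- rewrite wD wB wG mulrCA mulVf ?mulr1; lra.
- by rewrite wD wZ.
- rewrite wG wD wB wZ [D + _]addrC subrK (_ : q * e = q * (1 - p)); last by rewrite pE subKr.
  apply: (@surgery_cost _ _ _ _ _ _ (p * delta K beta u)) => //; try lra.
Qed.

End LinkDomination.

(** * Percolation and loops on finite subgraphs *)

Section Edges.
Variables (V : countType) (adj : rel V).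

Lemma edges_of_uniq S : uniq (edges_of adj S).
Proof.
apply/filter_uniq/allpairs_uniq; rewrite ?undup_uniq // => -[x y] [x' y'] _ _.
by [].
Qed.

Lemma mem_edges_of S p :
  (p \in edges_of adj S) =
  [&& p.1 \in S, p.2 \in S, adj p.1 p.2 & (pickle p.1 < pickle p.2)%N].
Proof.
rewrite mem_filter andbC [RHS]andbA; congr (_ && _).
apply/allpairsP/andP => [[[x y] /= [xS yS ->]]|[xS yS]].
  by rewrite !mem_undup in xS yS.
by exists p; rewrite !mem_undup -surjective_pairing.
Qed.

Variable S : seq V.
Let E := edges_of adj S.
Notation ends i := (tnth (in_tuple E) i).

Lemma endsP (i : 'I_(size E)) : adj (ends i).1 (ends i).2 /\ (pickle (ends i).1 < pickle (ends i).2)%N.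
Proof. by have := mem_tnth i (in_tuple E); rewrite mem_edges_of => /and4P[]. Qed.

Lemma ends_neq (i : 'I_(size E)) : (ends i).1 != (ends i).2.
Proof. by have [_] := endsP i; apply: contraTneq => ->; rewrite ltnn. Qed.

Lemma ends_inj : injective (fun i : 'I_(size E) => ends i).
Proof. by move=> i j; apply/tuple_uniqP; exact: edges_of_uniq. Qed.

Hypothesis adjC : symmetric adj.
Variable K : nat.
Hypothesis adj_deg : max_degree_le adj K.

(** An edge at [x] is determined by its other end: the ordering by [pickle] excludes that a pair
    occurs in both orientations. *)
Lemma card_incident x : (#|[pred i | incident (E := E) x i]| <= K)%N.
Proof.
rewrite -(size_image (other_end (E := E) x)); apply: (adj_deg (x := x)).
  rewrite map_inj_in_uniq ?enum_uniq // => i j; rewrite !mem_enum !inE => xi xj.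
  have [_ pi] := endsP i; have [_ pj] := endsP j.
  move: xi xj pi pj; rewrite /incident /other_end.
  case: (eqVneq x (ends i).1) => /= [xi _|_ /eqP xi];
    case: (eqVneq x (ends j).1) => /= [xj _|_ /eqP xj] pi pj ij;
    apply: ends_inj; rewrite /= [ends i]surjective_pairing [ends j]surjective_pairing.
  - by rewrite -xi -xj ij.
  - by move: pi pj; rewrite -xi -xj ij => h1 h2; have := ltn_trans h1 h2; rewrite ltnn.
  - by move: pi pj; rewrite -xi -xj -ij => h1 h2; have := ltn_trans h1 h2; rewrite ltnn.
  - by rewrite -xi -xj ij.
apply/allP => y /mapP[i]; rewrite mem_enum inE /incident /other_end => xi ->.
have [a _] := endsP i.
by move: xi; case: (eqVneq x (ends i).1) => /= [->//|_ /eqP ->]; rewrite adjC.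
Qed.

Lemma card_edge_nb i : (#|edge_nb (E := E) i| <= 2 * K.-1)%N.
Proof.
have side x : incident (E := E) x i ->
    (#|[pred j | (i != j) && incident (E := E) x j]| <= K.-1)%N.
  move=> xi; rewrite -ltnS; apply: (@leq_trans K); last by case: (K).
  apply: leq_trans (card_incident x); rewrite [X in (_ < X)%N](cardD1 i) inE xi add1n ltnS.
  by apply: subset_leq_card; apply/fintype.subsetP => j; rewrite !inE eq_sym.
pose A x := [pred j | (i != j) && incident (E := E) x j].
apply: (@leq_trans #|[predU A (ends i).1 & A (ends i).2]|).
  apply: subset_leq_card; apply/fintype.subsetP => j; rewrite !inE -topredE /= /edge_nb.
  by case: (i != j).
apply: leq_trans (leq_addr #|[predI A (ends i).1 & A (ends i).2]| _) _.
by rewrite cardUI mul2n -addnn leq_add // side // /incident eqxx ?orbT.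
Qed.

End Edges.

Section LoopWeight.
Variable R : realType.

Lemma loop_weightE k (beta u : R) (c : seq ('I_k * bool)) :
  loop_weight beta u c = expR (- (beta * k%:R)) * ((size c)`!%:R^-1 *
    (beta ^+ size c * \prod_(l <- c) (if l.2 then u else 1 - u))).
Proof.
rewrite /loop_weight -!mulrA; congr (_ * _); rewrite mulrCA; congr (_ * _).
congr (_ * _); elim: c => [|[i s] c IH]; first by rewrite big_nil !expr0 mulr1.
by rewrite big_cons -IH /=; case: s => /=; rewrite ?add0n ?add1n exprS; ring.
Qed.

End LoopWeight.

Section Percolation.
Variables (R : realType) (V : countType) (adj : rel V) (v0 : V).

Lemma perc_probE (E : seq (V * V)) (q : R) A :
  perc_prob (E := E) q A = iid (bern q) (fun x => (`[< A x >])%:R).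
Proof.
rewrite /perc_prob /iid big_mkcond; apply: eq_bigr => x _.
by case: ifP => _; rewrite ?mulr1 ?mulr0.
Qed.

Lemma bern_ge0 (q : R) b : 0 <= q <= 1 -> 0 <= bern q b.
Proof. by move=> /andP[q0 q1]; case: b; rewrite /bern ?subr_ge0. Qed.

Lemma perc_prob_ge0 (E : seq (V * V)) (q : R) A :
  0 <= q <= 1 -> 0 <= perc_prob (E := E) q A.
Proof. by move=> q01; rewrite perc_probE iid_ge0 // => b; exact: bern_ge0. Qed.

Lemma le_perc_prob (E : seq (V * V)) (q : R) (A B : {ffun 'I_(size E) -> bool} -> Prop) :
  0 <= q <= 1 -> (forall x, A x -> B x) -> perc_prob q A <= perc_prob q B.
Proof.
move=> q01 AB; rewrite !perc_probE; apply: ler_iid => [b|x]; first exact: bern_ge0.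
by rewrite ler_nat; case: asboolP => // /AB Bx; rewrite asboolT.
Qed.

Lemma perc_prob_le1 (E : seq (V * V)) (q : R) A :
  0 <= q <= 1 -> perc_prob (E := E) q A <= 1.
Proof.
move=> q01; rewrite perc_probE -[leRHS](@iid_cst R 'I_(size E) bool (bern q)) ?sum_bern //.
apply: ler_iid => [b|x]; first exact: bern_ge0.
by case: asboolP => _; rewrite ?ler01 ?lexx.
Qed.

(** Marginal of a product law: the coordinates outside the image of [h] sum out to 1. *)
Lemma iid_bern_restrict (I J : finType) (h : I -> J) (q : R) (f : {ffun I -> bool} -> R) :
  injective h ->
  iid (bern q) (fun x : {ffun J -> bool} => f [ffun i => x (h i)]) = iid (bern q) f.
Proof.
move=> h_inj; pose res (x : {ffun J -> bool}) : {ffun I -> bool} := [ffun i => x (h i)].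
rewrite /iid (partition_big res predT) //=; apply: eq_bigr => x _.
pose Q j b := [forall i, (h i == j) ==> (b == x i)].
transitivity ((\sum_(y in family Q) \prod_j bern q (y j)) * f x).
  rewrite mulr_suml; apply: eq_big => y; last by move=> /eqP <-.
  apply/eqP/familyP => [yx j|yQ].
    by rewrite unfold_in; apply/forallP => i; apply/implyP => /eqP <-; rewrite -yx ffunE.
  apply/ffunP => i; rewrite ffunE.
  by have := yQ (h i); rewrite unfold_in => /forallP/(_ i); rewrite eqxx => /eqP.
congr (_ * _); rewrite -(bigA_distr_big_dep Q (fun _ b => bern q b)) /=.
rewrite (bigID (mem [set h i | i in predT]%SET)) /= [X in _ * X]big1 => [|j jh]; last first.
  rewrite -[RHS](sum_bern q); apply: eq_bigl => b; apply/forallP => i.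
  by case: eqP => // hij; rewrite -hij imset_f // in jh.
rewrite mulr1 big_imset /= => [|? ? _ _]; last exact: h_inj.
apply: eq_big => [i|i _].
  by [].
rewrite (big_pred1 (x i)) // => b; apply/forallP/eqP => [/(_ i)|-> i'].
  by rewrite eqxx => /eqP.
by rewrite (inj_eq h_inj); apply/implyP => /eqP ->.
Qed.

Lemma perc_event_sub (E E' : seq (V * V)) (h : 'I_(size E) -> 'I_(size E')) r
    (x : {ffun 'I_(size E') -> bool}) :
  (forall i, tnth (in_tuple E') (h i) = tnth (in_tuple E) i) ->
  perc_event adj (E := E) v0 r [ffun i => x (h i)] -> perc_event adj (E := E') v0 r x.
Proof.
move=> hE [w [dw [p [pv pw]]]]; exists w; split => //; exists p; split => //.
apply: sub_path pv => a b /existsP[i]; rewrite ffunE => /andP[xi iab].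
by apply/existsP; exists (h i); rewrite xi hE.
Qed.

(** Percolation on [E'] restricted to [E] is percolation on [E], and an open path in [E] is open in
    [E']. *)
Lemma perc_prob_sub (E E' : seq (V * V)) (q : R) r :
  uniq E -> {subset E <= E'} -> 0 <= q <= 1 ->
  perc_prob q (perc_event adj (E := E) v0 r) <= perc_prob q (perc_event adj (E := E') v0 r).
Proof.
move=> uE EE' q01.
have hP i : (index (tnth (in_tuple E) i) E' < size E')%N.
  by rewrite index_mem EE' // mem_tnth.
pose h i := Ordinal (hP i).
have hE i : tnth (in_tuple E') (h i) = tnth (in_tuple E) i.
  by rewrite (tnth_nth (tnth (in_tuple E) i)) /= nth_index // EE' // mem_tnth.
have h_inj : injective h.
  move=> i j hij; apply: (elimT (tuple_uniqP (in_tuple E)) uE).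
  by rewrite -(hE i) hij hE.
rewrite [leLHS]perc_probE -(iid_bern_restrict q _ h_inj) perc_probE.
apply: ler_iid => [b|x]; first exact: bern_ge0.
rewrite ler_nat; case: asboolP => // /(perc_event_sub hE) ex.
by rewrite asboolT.
Qed.

Lemma perc_event_increasing (E : seq (V * V)) r :
  increasing (fun x => (`[< perc_event adj (E := E) v0 r x >])%:R : R).
Proof.
move=> x e; rewrite ler_nat; case: asboolP => // -[w [dw [p [pv pw]]]].
rewrite asboolT //; exists w; split => //; exists p; split => //.
apply: sub_path pv => a b /existsP[i] /andP[xi iab].
apply/existsP; exists i; rewrite iab andbT; move: xi; rewrite !ffunE.
by case: eqP.
Qed.

End Percolation.

(** * Loop connections against percolation *)

Section LoopProb.
Variables (R : realType) (V : countType) (adj : rel V) (v0 : V) (S : seq V) (r : nat).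
Variables (K : nat) (beta u q : R).
Hypotheses (adjC : symmetric adj) (adj_deg : max_degree_le adj K).
Hypotheses (K_ge2 : (2 <= K)%N) (beta_gt0 : 0 < beta) (u01 : 0 <= u <= 1).
Hypotheses (q01 : 0 <= q <= 1) (q_ge : (1 - expR (- beta)) * (1 - delta K beta u) <= q).
Let E := edges_of adj S.

Lemma loop_term_ge0 n (A : seq ('I_(size E) * bool) -> Prop) :
  0 <= \sum_(c : n.-tuple ('I_(size E) * bool) | `[< A (tval c) >])
          loop_weight beta u (tval c).
Proof.
have /andP[u0 u1] := u01; apply: sumr_ge0 => c _; rewrite /loop_weight.
by rewrite !mulr_ge0 ?invr_ge0 ?exprn_ge0 ?expR_ge0 ?subr_ge0 // ltW.
Qed.

Lemma loop_prob_ge0 A : (0 <= loop_prob (E := E) beta u A)%E.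
Proof. by apply: nneseries_ge0 => n _ _; rewrite lee_fin loop_term_ge0. Qed.

(** Links are flagged as inside or outside the window, loops are confined to clusters of open edges,
    and the types that determine these are i.i.d.; [link_domination] then applies. *)
Lemma loop_prob_le_perc_prob :
  (loop_prob (E := E) beta u (fun c =>
     exists w, [/\ w \in S, dist_ge adj v0 w r & same_loop (links c) v0 w])
   <= (perc_prob q (perc_event adj (E := E) v0 r))%:E)%E.
Proof.
set A := fun c => _; have E_irr := @ends_neq V adj S.
have [lam [mu [lam0 mu0 lm dom]]] := link_domination (@edge_nb_sym V E) (@edge_nb_irr V E)
  (card_edge_nb adjC adj_deg) K_ge2 beta_gt0 u01 q01 q_ge.
pose f x : R := (`[< perc_event adj (E := E) v0 r x >])%:R.
(* The terms are nonnegative, so it suffices to bound partial sums in the number of links. *)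
have partial N : \sum_(n < N) \sum_(c : n.-tuple ('I_(size E) * bool) | `[< A (tval c) >])
      loop_weight beta u (tval c) <= perc_prob q (perc_event adj (E := E) v0 r).
  rewrite perc_probE; apply: le_trans (dom _ (@perc_event_increasing R V adj v0 E r)).
  pose e := expR (- (beta * (size E)%:R)).
  apply: (@le_trans _ _ (e * psum (link_weight lam mu u) N
      (fun d => f (opened (edge_nb (E := E)) (link_types d))))).
    apply: (@le_trans _ _ (e * psum (link_weight lam mu u) N
        (fun d => (`[< A (win d ++ rev (out d)) >])%:R))).
      rewrite /psum mulr_sumr; apply: ler_sum => n _.
      have -> := @wsum_flags R _ lam mu (fun l : 'I_(size E) * bool => if l.2 then u else 1 - u)
        n (fun c => (`[< A c >])%:R).
      rewrite -sum_tuple_wsum lm big_mkcond 3!mulr_sumr; apply: ler_sum => c _.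
      rewrite loop_weightE size_tuple -/e; case: ifP => _; last by rewrite !mulr0.
      by rewrite mulr1.
    rewrite ler_wpM2l ?expR_ge0 //; apply: ler_psum => [l|d]; first exact: link_weight_ge0.
    rewrite ler_nat; case: asboolP => // -[w [_ dw /(same_loop_joined E_irr) vw]].
    by rewrite asboolT //; exists w.
  have := @link_types_psum_le R _ lam mu u lam0 mu0 u01
    (fun t => f (opened (edge_nb (E := E)) t)) N (fun t => ler0n _ _).
  rewrite card_ord lm => h; apply: le_trans (ler_wpM2l (expR_ge0 _) h) _.
  (* The normalisation of the loop measure cancels the exponential from the types. *)
  by rewrite mulrA -expRM_natr -expRD addrC subrr expR0 mul1r.
apply: lime_le.
  by apply: is_cvg_nneseries => n _ _; rewrite lee_fin loop_term_ge0.
by apply: nearW => N; rewrite /= big_mkord sumEFin lee_fin.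
Qed.

End LoopProb.

(** A connected graph of maximal degree at most one is a vertex or an edge, hence finite. The
    estimate on [delta] uses [2 <= K]. *)
Lemma degree_ge2 (V : countType) (adj : rel V) (K : nat) (v0 : V) :
  symmetric adj -> infinite_graph V -> connected_graph adj -> max_degree_le adj K ->
  (2 <= K)%N.
Proof.
move=> adjC Vinf conn deg; rewrite leqNgt; apply/negP => K1; apply: Vinf.
case: (pselect (exists y, adj v0 y)) => [[y v0y]|iso].
  have nb_unique x a b : adj x a -> adj x b -> a = b.
    move=> xa xb; apply/eqP; apply: contraT => ab.
    have := deg x [:: a; b]; rewrite /= inE ab xa xb => /(_ isT isT) K2.
    by have := leq_ltn_trans K2 K1.
  exists [:: v0; y] => x; have [p [pv <-]] := conn v0 x.
  have stay z s : z \in [:: v0; y] -> path adj z s -> last z s \in [:: v0; y].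
    elim: s z => [//|a s IH] z zin /= /andP[za]; apply: IH.
    move: zin; rewrite !inE; case/orP => /eqP zE; rewrite zE in za.
      by rewrite (nb_unique _ _ _ za v0y) eqxx orbT.
    by rewrite (nb_unique y a v0) ?eqxx // adjC.
  by apply: stay pv; rewrite inE eqxx.
exists [:: v0] => x; have [[|a p] [/= pv px]] := conn v0 x; first by rewrite inE px.
by case: iso; exists a; case/andP: pv.
Qed.

(** * Passage to the limit *)

Section Limits.
Variables (R : realType).

Lemma le_limn_einf (a b : (\bar R)^nat) :
  (forall n, (a n <= b n)%E) -> (limn_einf a <= limn_einf b)%E.
Proof.
move=> ab; rewrite !limn_einf_lim; apply: lee_lim; try exact: is_cvg_einfs.
apply: nearW => n; apply: le_ereal_inf_tmp => _ [k /= nk <-].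
by apply: ge_ereal_inf; exists (a k); [exists k | exact: ab].
Qed.

Lemma limn_einf_ge0 (a : (\bar R)^nat) :
  (forall n, (0 <= a n)%E) -> (0 <= limn_einf a)%E.
Proof.
move=> a0; have [<- _] := @cvg_limn_einf_sup R _ _ (cvg_cst (0 : \bar R)%E).
exact: le_limn_einf.
Qed.

Variables (V : countType) (adj : rel V) (Vm : nat -> seq V) (v0 : V) (q : R).
Hypothesis Vm_sub : forall m x, x \in Vm m -> x \in Vm m.+1.
Hypothesis q01 : 0 <= q <= 1.

(** Monotone in [m] and bounded by 1, so the [limn] in [theta_r] is a genuine limit. *)
Lemma perc_prob_cvg r :
  ((fun m => perc_prob q (@perc_event V adj (edges_of adj (Vm m)) v0 r)) : R^nat) @ \oo
    --> theta_r adj Vm v0 q r.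
Proof.
apply: nondecreasing_is_cvgn.
  apply/nondecreasing_seqP => m; apply: perc_prob_sub => //; first exact: edges_of_uniq.
  by move=> p; rewrite !mem_edges_of => /and4P[? ? -> ->]; rewrite !Vm_sub.
by exists 1 => _ [m _ <-]; exact: perc_prob_le1.
Qed.

Lemma theta_r_ge0 r : 0 <= theta_r adj Vm v0 q r.
Proof.
apply: limr_ge; first exact: perc_prob_cvg.
by apply: nearW => m; exact: perc_prob_ge0.
Qed.

(** The events shrink as [r] grows, so this [limn] is genuine too. *)
Lemma theta_cvg : (theta_r adj Vm v0 q : R^nat) @ \oo --> theta adj Vm v0 q.
Proof.
apply: nonincreasing_is_cvgn; last by exists 0 => _ [r _ <-]; exact: theta_r_ge0.
apply/nonincreasing_seqP => r; apply: ler_lim; try exact: perc_prob_cvg.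
apply: nearW => m; apply: le_perc_prob => // x [w [dw vw]]; exists w; split => //.
by move=> [p [pv pw ps]]; apply: dw; exists p; split => //; exact: ltnW.
Qed.

End Limits.

Theorem theorem1p2 (R : realType) (V : countType) (adj : rel V) (K : nat)
  (Vm : nat -> seq V) (v0 : V) (beta u : R) :
  simple_graph adj -> infinite_graph V -> connected_graph adj ->
  max_degree_le adj K ->
  (forall m x, x \in Vm m -> x \in Vm m.+1) ->
  (forall x, exists m, x \in Vm m) ->
  (forall m, induced_connected adj (Vm m)) ->
  v0 \in Vm 0 ->
  0 < beta -> 0 <= u <= 1 ->
  (1 - expR (- beta)) * (1 - delta K beta u) < p_c R adj Vm v0 ->
  limn_einf (fun r : nat =>
    limn_einf (fun m : nat =>
      loop_prob (E := edges_of adj (Vm m)) beta u (fun c =>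
        exists w, [/\ w \in Vm m, dist_ge adj v0 w r &
                      same_loop (links c) v0 w]))) = 0%E.
Proof.
move=> [adjC _] Vinf conn deg Vm_sub _ _ _ b0 u01 lt_pc.
have K2 : (2 <= K)%N := degree_ge2 v0 adjC Vinf conn deg.
have [q [q01 thetaq] le_q] : exists2 q : R, 0 <= q <= 1 /\ theta adj Vm v0 q = 0 &
    (1 - expR (- beta)) * (1 - delta K beta u) < q.
  move: lt_pc; rewrite /p_c; set S := [set p | _]%classic => lt_pc.
  (* The [sup] of the empty set is 0, and the threshold is not below 0, because [p * delta] is at
     most [p]. *)
  have [S0|/set0P S1] := eqVneq S set0%classic; last exact: sup_gt S1 lt_pc.
  exfalso; move: lt_pc; rewrite S0 sup0; apply/negP; rewrite -leNgt; have /= := delta_bound u K2 b0.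
  have e0 := expR_gt0 (- beta); have e1 : expR (- beta) < 1 by rewrite expR_lt1; lra.
  set p := 1 - expR (- beta); have /andP[u0 u1] := u01.
  have p0 : 0 < p by rewrite /p; lra.
  have K0 : 1 <= (6 * K%:R : R) by rewrite -natrM ler1n; lia.
  set x := p * (6 * K%:R)^-1 * u.
  have x0 : 0 <= x by rewrite !mulr_ge0 ?invr_ge0 ?(ltW p0) //; lra.
  have xp : x <= p.
    by rewrite /x -mulrA ler_piMr ?(ltW p0) // mulr_ile1 ?invr_ge0 ?invf_le1 //; lra.
  have xx : x * x <= 1 * p by rewrite ler_pM //; move: xp; rewrite /p; lra.
  have : (1 - p) * x ^+ 2 <= 1 * x ^+ 2 by rewrite ler_wpM2r ?sqr_ge0 //; lra.
  by rewrite expr2; lra.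
apply/eqP; rewrite eq_le; apply/andP; split; last first.
  apply: limn_einf_ge0 => r; apply: limn_einf_ge0 => m; exact: loop_prob_ge0.
have [theta0 _] : (limn_einf (fun r => (theta_r adj Vm v0 q r)%:E) = 0%E) *
                  (limn_esup (fun r => (theta_r adj Vm v0 q r)%:E) = 0%E).
  apply: cvg_limn_einf_sup; rewrite -[0%E]/(0%:E) -thetaq.
  apply: cvg_EFin; first exact: nearW.
  exact: theta_cvg.
(* The comparison is made for each [r] and [m]; the percolation probabilities converge, so their
   lower limits are [theta_r] and then [theta], which vanishes at [q]. *)
rewrite -theta0; apply: le_limn_einf => r.
have [<- _] : (limn_einf (fun m => (perc_prob q
     (@perc_event V adj (edges_of adj (Vm m)) v0 r))%:E) = (theta_r adj Vm v0 q r)%:E) *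
   (limn_esup (fun m => (perc_prob q
     (@perc_event V adj (edges_of adj (Vm m)) v0 r))%:E) = (theta_r adj Vm v0 q r)%:E).
  apply: cvg_limn_einf_sup; apply: cvg_EFin; first exact: nearW.
  exact: perc_prob_cvg.
apply: le_limn_einf => m.
exact: loop_prob_le_perc_prob adjC deg K2 b0 u01 q01 (ltW le_q).
Qed.
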